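(* If $P$ is a normal finitely recursive program, then there exists a complete $\mathsf{CounterSupp}$ function for $P$ such that for every atom $A$, the set $\mathsf{CounterSupp}(A)$ is recursively enumerable.
   Context: A normal program is a finite set of rules $A\leftarrow L_1,\dots,L_n$ ($A$ an atom, $L_i$ atoms or negated atoms $\mathtt{not}\,B$), possibly with function symbols; $\mathsf{Ground}(P)$ is its ground instantiation. The dependency graph has an edge from $A$ to each atom occurring in the body of a ground rule with head $A$; $A$ depends on $B$ if there is a directed path from $A$ to $B$ (each atom depends on itself); $P$ is finitely recursive iff each ground atom depends on finitely many ground atoms. A support for a ground atom $A$ is a set of negative literals that is the final goal of an SLD derivation from $A$ using $\mathsf{Ground}(P)$ in which only positive literals are resolved, ending when no positive literal is left. A ground counter-support for $A$ is a set $K$ of ground atoms such that (1) every support $S$ of $A$ contains some $\mathtt{not}\,B$ with $B\in K$, and (2) for each $B\in K$ some support of $A$ contains $\mathtt{not}\,B$. A (generalized) counter-support for an atom $A$ is a pair $\langle K,\theta\rangle$, $K$ a set of atoms and $\theta$ a substitution, such that for every grounding substitution $\sigma$, $K\sigma$ is a ground counter-support for $A\theta\sigma$. A $\mathsf{CounterSupp}$ function maps each (possibly nonground) atom $A$ to a set of finite generalized counter-supports for $A$; it is complete iff for every atom $A$, every ground instance $A\gamma$ and every ground counter-support $K$ of $A\gamma$, there exist $\langle K',\theta\rangle\in\mathsf{CounterSupp}(A)$ and a substitution $\sigma$ with $A\theta\sigma=A\gamma$ and $K'\sigma=K$. *)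

(* Defs.v *)
From Stdlib Require Import List Arith Relations.
Import ListNotations.

Inductive term : Type :=
| Var : nat -> term
| Fn : nat -> list term -> term.

(* A (first-order) signature: a finite list of function symbols with arities.
   Constants are symbols of arity 0. *)
Definition signature := list (nat * nat).

Fixpoint term_over (Sg : signature) (t : term) : Prop :=
  match t with
  | Var _ => True
  | Fn f ts =>
      In (f, length ts) Sg /\
      (fix go (l : list term) : Prop :=
         match l with [] => True | u :: l' => term_over Sg u /\ go l' end) ts
  end.

Fixpoint ground_term (t : term) : Prop :=
  match t with
  | Var _ => False
  | Fn _ ts =>
      (fix go (l : list term) : Prop :=
         match l with [] => True | u :: l' => ground_term u /\ go l' end) ts
  end.

Fixpoint tsubst (s : nat -> term) (t : term) : term :=
  match t with
  | Var x => s x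
  | Fn f ts => Fn f (map (tsubst s) ts)
  end.

Record atom : Type := At { apred : nat; aargs : list term }.

Definition asubst (s : nat -> term) (A : atom) : atom :=
  At (apred A) (map (tsubst s) (aargs A)).

Definition atom_over (Sg : signature) (A : atom) : Prop :=
  Forall (term_over Sg) (aargs A).

Definition ground_atom (A : atom) : Prop := Forall ground_term (aargs A).

Inductive literal : Type :=
| Pos : atom -> literal
| Neg : atom -> literal.

Definition lit_atom (l : literal) : atom :=
  match l with Pos a => a | Neg a => a end.

Definition lsubst (s : nat -> term) (l : literal) : literal :=
  match l with Pos a => Pos (asubst s a) | Neg a => Neg (asubst s a) end.

Record rule : Type := Rule { head : atom; body : list literal }.

Definition rsubst (s : nat -> term) (r : rule) : rule :=
  Rule (asubst s (head r)) (map (lsubst s) (body r)).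

Definition program := list rule.

Definition program_over (Sg : signature) (P : program) : Prop :=
  forall r, In r P ->
    atom_over Sg (head r) /\ forall l, In l (body r) -> atom_over Sg (lit_atom l).

Definition fsubst := list (nat * term).

Definition fsubst_fun (th : fsubst) (x : nat) : term :=
  match find (fun p => Nat.eqb (fst p) x) th with
  | Some p => snd p
  | None => Var x
  end.

Definition grounding (Sg : signature) (s : nat -> term) : Prop :=
  forall x, term_over Sg (s x) /\ ground_term (s x).

Definition ground_instance (Sg : signature) (P : program) (r : rule) : Prop :=
  exists r0 s, In r0 P /\ grounding Sg s /\ r = rsubst s r0.

Definition dep_edge (Sg : signature) (P : program) (A B : atom) : Prop :=
  exists r, ground_instance Sg P r /\ head r = A /\
            (In (Pos B) (body r) \/ In (Neg B) (body r)).

Definition depends (Sg : signature) (P : program) : atom -> atom -> Prop :=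
  clos_refl_trans atom (dep_edge Sg P).

Definition finitely_recursive (Sg : signature) (P : program) : Prop :=
  forall A, atom_over Sg A -> ground_atom A ->
    exists l : list atom, forall B, depends Sg P A B -> In B l.

Definition sld_step (Sg : signature) (P : program) (G G' : list literal) : Prop :=
  exists G1 G2 B r,
    G = G1 ++ Pos B :: G2 /\ ground_instance Sg P r /\ head r = B /\
    G' = G1 ++ body r ++ G2.

Definition is_support (Sg : signature) (P : program) (A : atom) (S : atom -> Prop) : Prop :=
  exists G, clos_refl_trans (list literal) (sld_step Sg P) [Pos A] G /\
            (forall B, ~ In (Pos B) G) /\
            (forall B, S B <-> In (Neg B) G).

Definition ground_counter_support (Sg : signature) (P : program) (A : atom)
    (K : atom -> Prop) : Prop :=
  (forall B, K B -> ground_atom B) /\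
  (forall S, is_support Sg P A S -> exists B, S B /\ K B) /\
  (forall B, K B -> exists S, is_support Sg P A S /\ S B).

Definition image_subst (s : nat -> term) (K : list atom) : atom -> Prop :=
  fun B => exists B0, In B0 K /\ B = asubst s B0.

Definition gen_counter_support (Sg : signature) (P : program) (A : atom)
    (c : list atom * fsubst) : Prop :=
  forall s, grounding Sg s ->
    ground_counter_support Sg P (asubst s (asubst (fsubst_fun (snd c)) A))
      (image_subst s (fst c)).

Definition counter_supp_function (Sg : signature) (P : program)
    (CS : atom -> list atom * fsubst -> Prop) : Prop :=
  forall A c, CS A c -> gen_counter_support Sg P A c.

Definition complete_counter_supp (Sg : signature) (P : program)
    (CS : atom -> list atom * fsubst -> Prop) : Prop :=
  forall A g, atom_over Sg A -> grounding Sg g ->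
    forall K, ground_counter_support Sg P (asubst g A) K ->
      exists c, CS A c /\
        exists s, asubst s (asubst (fsubst_fun (snd c)) A) = asubst g A /\
                  (forall B, K B <-> image_subst s (fst c) B).

Inductive prf : Type :=
| PZero
| PSucc
| PProj (i : nat)
| PComp (f : prf) (gs : list prf)
| PRec (f g : prf)
| PMu (f : prf).

Inductive peval : prf -> list nat -> nat -> Prop :=
| ev_zero v : peval PZero v 0
| ev_succ x v : peval PSucc (x :: v) (S x)
| ev_proj i v : peval (PProj i) v (nth i v 0)
| ev_comp f gs v ws y :
    peval_list gs v ws -> peval f ws y -> peval (PComp f gs) v y
| ev_rec0 f g v y : peval f v y -> peval (PRec f g) (0 :: v) y
| ev_recS f g n v r y :
    peval (PRec f g) (n :: v) r -> peval g (n :: r :: v) y ->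
    peval (PRec f g) (S n :: v) y
| ev_mu f v y :
    peval f (y :: v) 0 ->
    (forall z, z < y -> exists w, peval f (z :: v) (S w)) ->
    peval (PMu f) v y
with peval_list : list prf -> list nat -> list nat -> Prop :=
| evl_nil v : peval_list [] v []
| evl_cons g gs v w ws :
    peval g v w -> peval_list gs v ws -> peval_list (g :: gs) v (w :: ws).

Definition re (X : nat -> Prop) : Prop :=
  exists e : prf, forall n, X n <-> exists y, peval e [n] y.

Definition cpair (a b : nat) : nat := (a + b) * (a + b + 1) / 2 + b.

Definition enc_list (l : list nat) : nat :=
  fold_right (fun x acc => S (cpair x acc)) 0 l.

Fixpoint enc_term (t : term) : nat :=
  match t with
  | Var x => cpair 0 x
  | Fn f ts => cpair 1 (cpair f (enc_list (map enc_term ts)))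
  end.

Definition enc_atom (A : atom) : nat :=
  cpair (apred A) (enc_list (map enc_term (aargs A))).

Definition enc_fsubst (th : fsubst) : nat :=
  enc_list (map (fun p => cpair (fst p) (enc_term (snd p))) th).

Definition enc_cs (c : list atom * fsubst) : nat :=
  cpair (enc_list (map enc_atom (fst c))) (enc_fsubst (snd c)).

(* Main.v *)
(** The function sends [A] to all pairs of a ground substitution [th] of its variables
    and a list of the elements of a ground counter-support of [A th].  Completeness holds
    because a counter-support of a ground atom consists of atoms it depends on.  For
    enumerability, a finite set [K] meets every support of [B] iff some finite set [U]
    contains [B] and satisfies: every ground rule with head in [U] has a negated body
    atom in [K] or a positive body atom in [U].  Finite recursion makes the atoms that
    are reachable from [B] and have no support avoiding [K] into such a finite set.
    Checking [U] quantifies over all rules with a given head; this is a bounded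
    quantifier, since body variables may be assumed to occur in heads. *)

From Stdlib Require Import List Arith Lia Relations Classical ClassicalEpsilon.
Require Import Defs.
Import ListNotations.

(** * Recursively enumerable sets *)

(** Condition (2) of a counter-support is existential, but condition (1) speaks of all supports, and
    the derivations that produce them may have unbounded length. The set [U] of the overview is a
    finite certificate for (1): it is an unfounded set, in the sense of the well-founded semantics,
    relative to the truth of the atoms of [K]. Cycles inside [U] are harmless because every
    derivation is a finite tree. The assumption on body variables is reached by passing to a program
    with the same ground instances. That program is obtained by a classical case distinction; this
    is enough, since recursive enumerability only asks that some index exist. For the same reason
    the finite sets used as witnesses may be chosen classically: only the predicates that test them
    on codes must be semidecidable. *)

Lemma prf_nested_ind (Q : prf -> Prop) :
  Q PZero -> Q PSucc -> (forall i, Q (PProj i)) ->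
  (forall f gs, Q f -> Forall Q gs -> Q (PComp f gs)) ->
  (forall f g, Q f -> Q g -> Q (PRec f g)) ->
  (forall f, Q f -> Q (PMu f)) ->
  forall e, Q e.
Proof.
  intros Hz Hs Hp Hc Hr Hm.
  fix IH 1. intros [| |i|f gs|f g|f].
  - exact Hz.
  - exact Hs.
  - apply Hp.
  - apply Hc; [apply IH|].
    induction gs as [|g gs IHgs]; constructor; [apply IH|exact IHgs].
  - apply Hr; apply IH.
  - apply Hm; apply IH.
Qed.

(** Used to read a minimisation backwards: a value of [PMu e] yields an evaluation of [e] to 0,
    which has to agree with the known value of the function computed by [e]. *)
Lemma peval_functional e : forall v y y', peval e v y -> peval e v y' -> y = y'.
Proof.
  induction e as [| |i|f gs IHf IHgs|f g IHf IHg|f IHf] using prf_nested_ind;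
    intros v y y' H H'.
  - inversion H; inversion H'; congruence.
  - inversion H; inversion H'; congruence.
  - inversion H; inversion H'; congruence.
  - inversion H as [| | |? ? ? ws ? Hl Hf| | |]; subst.
    inversion H' as [| | |? ? ? ws' ? Hl' Hf'| | |]; subst.
    assert (ws = ws') as <-; [|eauto].
    clear H H' Hf Hf'. revert ws ws' Hl Hl'.
    induction IHgs as [|g gs Hg _ IH]; intros ws ws' Hl Hl';
      inversion Hl; inversion Hl'; subst; f_equal; eauto.
  - destruct v as [|n v]; [inversion H|].
    revert y y' H H'. induction n as [|n IHn]; intros y y' H H'.
    + inversion H; inversion H'; subst; eauto.
    + inversion H as [| | | | |? ? ? ? r ? Hr Hg|]; subst.
      inversion H' as [| | | | |? ? ? ? r' ? Hr' Hg'|]; subst.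
      assert (r = r') as <- by eauto. eauto.
  - inversion H as [| | | | | |? ? ? H0 Hlt]; subst.
    inversion H' as [| | | | | |? ? ? H0' Hlt']; subst.
    destruct (Nat.lt_trichotomy y y') as [Hy|[Hy|Hy]]; [|exact Hy|].
    + destruct (Hlt' _ Hy) as [w Hw]. discriminate (IHf _ _ _ H0 Hw).
    + destruct (Hlt _ Hy) as [w Hw]. discriminate (IHf _ _ _ H0' Hw).
Qed.

(** Totality on lists of every length makes it unnecessary to track arities: arguments are read by
    [nth], and missing ones count as 0. *)
Definition computable (f : list nat -> nat) : Prop :=
  exists e, forall v, peval e v (f v).

Lemma computable_proj i : computable (fun v => nth i v 0).
Proof. exists (PProj i). intros v. constructor. Qed.

Lemma computable_comp1 (F f : list nat -> nat) :
  computable F -> computable f -> computable (fun v => F [f v]).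
Proof.
  intros [e He] [d Hd]. exists (PComp e [d]). intros v.
  econstructor; [|apply He]. repeat constructor; auto.
Qed.

Lemma computable_S f : computable f -> computable (fun v => S (f v)).
Proof.
  intros [d Hd]. exists (PComp PSucc [d]). intros v.
  econstructor; [|constructor]. repeat constructor; auto.
Qed.

Lemma computable_const c : computable (fun _ => c).
Proof.
  induction c as [|c IH].
  - exists PZero. intros v. constructor.
  - exact (computable_S _ IH).
Qed.

(** A single parameter [x] is carried through the recursion, since several can be packed into one.
    The order [[i; r; x]] is that of [ev_recS]. *)
Lemma computable_rec (b g t x : list nat -> nat) :
  computable b -> computable g -> computable t -> computable x ->
  computable (fun v => nat_rect (fun _ => nat) (b [x v])
                         (fun i r => g [i; r; x v]) (t v)).
Proof.
  intros [eb Hb] [eg Hg] [et Ht] [ex Hx].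
  exists (PComp (PRec eb eg) [et; ex]). intros v.
  econstructor.
  - repeat constructor; [apply Ht|apply Hx].
  - induction (t v) as [|n IH]; cbn.
    + constructor. apply Hb.
    + econstructor; [exact IH|apply Hg].
Qed.

Lemma computable_ext f g : (forall v, g v = f v) -> computable f -> computable g.
Proof. intros H [e He]. exists e. intros v. rewrite H. apply He. Qed.

Lemma computable_add f g :
  computable f -> computable g -> computable (fun v => f v + g v).
Proof.
  intros Hf Hg.
  apply computable_ext with (f := fun v => nat_rect (fun _ => nat) (nth 0 [g v] 0)
         (fun i r => S (nth 1 [i; r; g v] 0)) (f v)).
  - intros v. cbn. induction (f v) as [|n IH]; cbn; congruence.
  - apply (computable_rec (fun v => nth 0 v 0) (fun v => S (nth 1 v 0)));
      auto using computable_proj, computable_S.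
Qed.

Lemma computable_mul f g :
  computable f -> computable g -> computable (fun v => f v * g v).
Proof.
  intros Hf Hg.
  apply computable_ext with (f := fun v => nat_rect (fun _ => nat) 0
         (fun i r => nth 2 [i; r; g v] 0 + nth 1 [i; r; g v] 0) (f v)).
  - intros v. cbn. induction (f v) as [|n IH]; cbn; congruence.
  - apply (computable_rec (fun v => 0) (fun v => nth 2 v 0 + nth 1 v 0));
      auto using computable_proj, computable_const, computable_add.
Qed.

Lemma computable_pred f : computable f -> computable (fun v => pred (f v)).
Proof.
  intros Hf.
  apply computable_ext with (f := fun v => nat_rect (fun _ => nat) 0
         (fun i r => nth 0 [i; r; 0] 0) (f v)).
  - intros v. destruct (f v); reflexivity.
  - apply (computable_rec (fun v => 0) (fun v => nth 0 v 0) f (fun _ => 0));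
      auto using computable_proj, computable_const.
Qed.

Lemma computable_sub f g :
  computable f -> computable g -> computable (fun v => f v - g v).
Proof.
  intros Hf Hg.
  apply computable_ext with (f := fun v => nat_rect (fun _ => nat) (nth 0 [f v] 0)
         (fun i r => pred (nth 1 [i; r; f v] 0)) (g v)).
  - intros v. cbn. induction (g v) as [|n IH]; cbn; [lia|]. rewrite <- IH. lia.
  - apply (computable_rec (fun v => nth 0 v 0) (fun v => pred (nth 1 v 0)));
      auto using computable_proj, computable_pred.
Qed.

(** * Inverting the pairing function *)

(** Triangular numbers by primitive recursion, which avoids computing the division by 2 in
    [cpair]. *)
Definition tri (n : nat) : nat := nat_rect (fun _ => nat) 0 (fun i r => S i + r) n.

Lemma tri_S n : tri (S n) = S n + tri n.
Proof. reflexivity. Qed.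

Lemma cpair_tri a b : cpair a b = tri (a + b) + b.
Proof.
  unfold cpair. f_equal. generalize (a + b). intros n.
  assert (H : n * (n + 1) = tri n * 2).
  { induction n as [|n IH]; [reflexivity|]. rewrite tri_S. nia. }
  rewrite H. apply Nat.div_mul. lia.
Qed.

(** The largest [r] with [tri r <= n]. It grows by at most one at each step, and the truncated
    difference is 1 exactly when [tri (S r) <= S i]. *)
Definition tri_root (n : nat) : nat :=
  nat_rect (fun _ => nat) 0 (fun i r => r + (1 - (tri (S r) - S i))) n.

Lemma tri_root_spec n : tri (tri_root n) <= n < tri (S (tri_root n)).
Proof.
  induction n as [|n IH]; [cbn; lia|].
  change (tri_root (S n)) with
    (tri_root n + (1 - (tri (S (tri_root n)) - S n))).
  set (r := tri_root n) in *. destruct (le_lt_dec (tri (S r)) (S n)).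
  - replace (r + (1 - (tri (S r) - S n))) with (S r) by lia.
    rewrite (tri_S (S r)). lia.
  - replace (r + (1 - (tri (S r) - S n))) with r by lia. lia.
Qed.

Lemma tri_mono a b : a <= b -> tri a <= tri b.
Proof. induction 1 as [|b _ IH]; [lia|]. rewrite tri_S. lia. Qed.

Definition usnd (n : nat) : nat := n - tri (tri_root n).
Definition ufst (n : nat) : nat := tri_root n - usnd n.

Lemma tri_root_cpair a b : tri_root (cpair a b) = a + b.
Proof.
  rewrite cpair_tri. pose proof (tri_root_spec (tri (a + b) + b)) as H.
  set (r := tri_root _) in *.
  destruct (Nat.lt_trichotomy r (a + b)) as [Hr|[Hr|Hr]]; [|exact Hr|].
  - pose proof (tri_mono (S r) (a + b)). lia.
  - pose proof (tri_mono (S (a + b)) r). pose proof (tri_S (a + b)). lia.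
Qed.

Lemma usnd_cpair a b : usnd (cpair a b) = b.
Proof. unfold usnd. rewrite tri_root_cpair, cpair_tri. lia. Qed.

Lemma ufst_cpair a b : ufst (cpair a b) = a.
Proof. unfold ufst. rewrite usnd_cpair, tri_root_cpair. lia. Qed.

Lemma cpair_unpair n : cpair (ufst n) (usnd n) = n.
Proof.
  pose proof (tri_root_spec n) as H. rewrite tri_S in H.
  rewrite cpair_tri. unfold ufst, usnd.
  replace (tri_root n - (n - tri (tri_root n)) + (n - tri (tri_root n)))
    with (tri_root n) by lia. lia.
Qed.

Lemma cpair_inj a b a' b' : cpair a b = cpair a' b' -> a = a' /\ b = b'.
Proof.
  intros H. split.
  - rewrite <- (ufst_cpair a b), H. apply ufst_cpair.
  - rewrite <- (usnd_cpair a b), H. apply usnd_cpair.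
Qed.

Lemma cpair_mono a b a' b' : a <= a' -> b <= b' -> cpair a b <= cpair a' b'.
Proof.
  intros. rewrite !cpair_tri. pose proof (tri_mono (a + b) (a' + b')). lia.
Qed.

Lemma cpair_ge_l a b : a <= cpair a b.
Proof.
  rewrite cpair_tri. enough (a + b <= tri (a + b)) by lia.
  induction (a + b) as [|n IH]; [lia|]. rewrite tri_S. lia.
Qed.

Lemma cpair_ge_r a b : b <= cpair a b.
Proof. rewrite cpair_tri. lia. Qed.

Lemma computable_tri f : computable f -> computable (fun v => tri (f v)).
Proof.
  intros Hf.
  apply (computable_rec (fun _ => 0) (fun v => S (nth 0 v 0) + nth 1 v 0) f (fun _ => 0));
    auto using computable_const, computable_add, computable_S, computable_proj.
Qed.

Lemma computable_tri_root f : computable f -> computable (fun v => tri_root (f v)).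
Proof.
  intros Hf.
  apply (computable_rec (fun _ => 0)
           (fun v => nth 1 v 0 + (1 - (tri (S (nth 1 v 0)) - S (nth 0 v 0))))
           f (fun _ => 0));
    auto 10 using computable_const, computable_add, computable_sub, computable_tri,
      computable_S, computable_proj.
Qed.

(* Tuples are coded by [cpair], so that unary functions suffice. *)
Definition comp (f : nat -> nat) : Prop := computable (fun v => f (nth 0 v 0)).

Lemma comp_id : comp (fun n => n).
Proof. apply computable_proj. Qed.

Lemma comp_const c : comp (fun _ => c).
Proof. exact (computable_const c). Qed.

Lemma comp_S f : comp f -> comp (fun n => S (f n)).
Proof. exact (computable_S _). Qed.

Lemma comp_pred f : comp f -> comp (fun n => pred (f n)).
Proof. exact (computable_pred _). Qed.

Lemma comp_add f g : comp f -> comp g -> comp (fun n => f n + g n).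
Proof. exact (computable_add _ _). Qed.

Lemma comp_mul f g : comp f -> comp g -> comp (fun n => f n * g n).
Proof. exact (computable_mul _ _). Qed.

Lemma comp_sub f g : comp f -> comp g -> comp (fun n => f n - g n).
Proof. exact (computable_sub _ _). Qed.

Lemma comp_cpair f g : comp f -> comp g -> comp (fun n => cpair (f n) (g n)).
Proof.
  intros Hf Hg.
  eapply computable_ext; [intros v; apply cpair_tri|].
  auto using computable_add, computable_tri.
Qed.

Lemma comp_usnd f : comp f -> comp (fun n => usnd (f n)).
Proof. intros Hf. apply computable_sub; auto using computable_tri, computable_tri_root. Qed.

Lemma comp_ufst f : comp f -> comp (fun n => ufst (f n)).
Proof.
  intros Hf. apply computable_sub; [apply computable_tri_root, Hf|apply comp_usnd, Hf].
Qed.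

Lemma comp_comp f g : comp f -> comp g -> comp (fun n => f (g n)).
Proof. intros Hf Hg. exact (computable_comp1 _ _ Hf Hg). Qed.

Lemma comp_iter g t x :
  comp g -> comp t -> comp x -> comp (fun n => Nat.iter (t n) g (x n)).
Proof.
  intros Hg Ht Hx.
  apply computable_ext with (f := fun v => nat_rect (fun _ => nat) (nth 0 [x (nth 0 v 0)] 0)
         (fun i r => g (nth 0 [nth 1 [i; r; x (nth 0 v 0)] 0] 0)) (t (nth 0 v 0))).
  - intros v. unfold Nat.iter. cbn. induction (t _) as [|n IH]; cbn; congruence.
  - apply (computable_rec (fun v => nth 0 v 0) (fun v => g (nth 0 [nth 1 v 0] 0)));
      auto using computable_proj.
    apply (computable_comp1 (fun v => g (nth 0 v 0)) (fun v => nth 1 v 0));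
      auto using computable_proj.
Qed.

Lemma enc_list_cons x L : enc_list (x :: L) = S (cpair x (enc_list L)).
Proof. reflexivity. Qed.

Definition ifz (c x y : nat) : nat := match c with 0 => x | S _ => y end.

Lemma comp_ifz c f g :
  comp c -> comp f -> comp g -> comp (fun n => ifz (c n) (f n) (g n)).
Proof.
  intros Hc Hf Hg.
  (* Truncated [1 - c] is 1 if [c] is 0 and 0 otherwise, so the sum selects a branch
     arithmetically. *)
  assert (H : comp (fun n => (1 - c n) * f n + (1 - (1 - c n)) * g n))
    by auto using comp_add, comp_mul, comp_sub, comp_const.
  eapply computable_ext; [|exact H].
  intros v. cbv beta. destruct (c _); unfold ifz; cbn; lia.
Qed.

(** * Semidecidable predicates *)

(** The test [f] is total, so that closure properties become arithmetic: sums give conjunctions,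
    products give disjunctions. *)
Definition semi (R : nat -> Prop) : Prop :=
  exists f, comp f /\ forall n, R n <-> exists w, f (cpair n w) = 0.

(** [ev_mu] demands nonzero values at all smaller arguments, so the search has to end at the least
    witness. *)
Lemma least_zero (h : nat -> nat) w :
  h w = 0 -> exists y, h y = 0 /\ forall z, z < y -> h z <> 0.
Proof.
  induction w as [w IH] using lt_wf_ind. intros Hw.
  destruct (classic (exists z, z < w /\ h z = 0)) as [[z [Hz Hz0]]|Hno].
  - exact (IH z Hz Hz0).
  - exists w. split; [exact Hw|]. intros z Hz Hz0. apply Hno. eauto.
Qed.

Lemma semi_re R : semi R -> re R.
Proof.
  intros [f [Hf HR]].
  (* [PMu] puts the candidate in front of the input, hence the swapped indices. *)
  assert (H : computable (fun v => f (cpair (nth 1 v 0) (nth 0 v 0)))).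
  { apply (computable_comp1 (fun v => f (nth 0 v 0))
             (fun v => cpair (nth 1 v 0) (nth 0 v 0))); [exact Hf|].
    apply (computable_ext (fun v => tri (nth 1 v 0 + nth 0 v 0) + nth 0 v 0)).
    - intros v. apply cpair_tri.
    - auto using computable_add, computable_tri, computable_proj. }
  destruct H as [e He]. exists (PMu e). intros n. rewrite HR. split.
  - intros [w Hw].
    destruct (least_zero (fun w => f (cpair n w)) w Hw) as [y [Hy Hlt]].
    exists y. constructor.
    + rewrite <- Hy. apply (He [y; n]).
    + intros z Hz. specialize (He [z; n]). specialize (Hlt z Hz).
      exists (pred (f (cpair n z))). rewrite Nat.succ_pred by exact Hlt. exact He.
  - intros [y Hy]. exists y.
    inversion Hy as [| | | | | |? ? ? H0 Hlt]; subst.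
    exact (peval_functional _ _ _ _ (He [y; n]) H0).
Qed.

Ltac comp_step :=
  match goal with
  | |- comp (fun n => n) => apply comp_id
  | |- comp (fun _ => ?c) => apply comp_const
  | |- comp ufst => exact (comp_ufst _ comp_id)
  | |- comp usnd => exact (comp_usnd _ comp_id)
  | |- comp (fun n => S _) => apply comp_S
  | |- comp (fun n => pred _) => apply comp_pred
  | |- comp (fun n => _ + _) => apply comp_add
  | |- comp (fun n => _ * _) => apply comp_mul
  | |- comp (fun n => _ - _) => apply comp_sub
  | |- comp (fun n => cpair _ _) => apply comp_cpair
  | |- comp (fun n => usnd _) => apply comp_usnd
  | |- comp (fun n => ufst _) => apply comp_ufst
  | |- comp (fun n => ifz _ _ _) => apply comp_ifz
  | |- comp (fun n => Nat.iter _ _ _) => apply comp_iter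
  | H : comp ?f |- comp ?f => exact H
  | H : comp ?f |- comp (fun n => ?f _) => apply (comp_comp f); [exact H|]
  end.
Ltac comp_tac := repeat comp_step.

Lemma semi_ext R Q : (forall n, Q n <-> R n) -> semi R -> semi Q.
Proof.
  intros H [f [Hf HR]]. exists f. split; [exact Hf|]. intros n. rewrite H. apply HR.
Qed.

Lemma semi_zero f : comp f -> semi (fun n => f n = 0).
Proof.
  intros Hf. exists (fun n => f (ufst n)). split; [comp_tac|].
  intros n. split.
  - intros H. exists 0. now rewrite ufst_cpair.
  - intros [w H]. now rewrite ufst_cpair in H.
Qed.

Lemma semi_eq f g : comp f -> comp g -> semi (fun n => f n = g n).
Proof.
  intros Hf Hg. apply (semi_ext (fun n => (f n - g n) + (g n - f n) = 0)).
  - intros n. lia.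
  - apply semi_zero. comp_tac.
Qed.

Lemma semi_ne f g : comp f -> comp g -> semi (fun n => f n <> g n).
Proof.
  intros Hf Hg. apply (semi_ext (fun n => 1 - ((f n - g n) + (g n - f n)) = 0)).
  - intros n. lia.
  - apply semi_zero. comp_tac.
Qed.

Lemma semi_const (Q : Prop) : semi (fun _ => Q).
Proof.
  destruct (classic Q) as [H|H].
  - apply (semi_ext (fun _ => 0 = 0)); [tauto|]. apply semi_eq; comp_tac.
  - apply (semi_ext (fun _ => 0 = 1)); [|apply semi_eq; comp_tac].
    intros _. split; [tauto|discriminate].
Qed.

Lemma semi_and R Q : semi R -> semi Q -> semi (fun n => R n /\ Q n).
Proof.
  intros [f [Hf HR]] [g [Hg HQ]].
  exists (fun m => f (cpair (ufst m) (ufst (usnd m))) + g (cpair (ufst m) (usnd (usnd m)))).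
  split; [comp_tac|]. intros n. rewrite HR, HQ. split.
  - intros [[w Hw] [w' Hw']]. exists (cpair w w').
    rewrite ?ufst_cpair, ?usnd_cpair, ?ufst_cpair. lia.
  - intros [w Hw]. rewrite ?ufst_cpair, ?usnd_cpair in Hw.
    split; [exists (ufst w)|exists (usnd w)]; lia.
Qed.

Lemma semi_or R Q : semi R -> semi Q -> semi (fun n => R n \/ Q n).
Proof.
  intros [f [Hf HR]] [g [Hg HQ]].
  exists (fun m => f m * g m).
  split; [comp_tac|]. intros n. rewrite HR, HQ. split.
  - intros [[w Hw]|[w Hw]]; exists w; lia.
  - intros [w Hw]. apply Nat.mul_eq_0 in Hw. destruct Hw; eauto.
Qed.

Lemma semi_ex (R : nat -> nat -> Prop) :
  semi (fun m => R (ufst m) (usnd m)) -> semi (fun n => exists x, R n x).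
Proof.
  intros [f [Hf HR]].
  exists (fun m => f (cpair (cpair (ufst m) (ufst (usnd m))) (usnd (usnd m)))).
  split; [comp_tac|]. intros n. split.
  - intros [x Hx].
    destruct (proj1 (HR (cpair n x))) as [w Hw]; [now rewrite ufst_cpair, usnd_cpair|].
    exists (cpair x w). now rewrite ?ufst_cpair, ?usnd_cpair, ?ufst_cpair.
  - intros [w Hw]. rewrite ?ufst_cpair, ?usnd_cpair in Hw.
    exists (ufst w). pose proof (proj2 (HR (cpair n (ufst w)))) as H.
    rewrite ufst_cpair, usnd_cpair in H. eauto.
Qed.

Lemma semi_comp R h : semi R -> comp h -> semi (fun n => R (h n)).
Proof.
  intros [f [Hf HR]] Hh. exists (fun m => f (cpair (h (ufst m)) (usnd m))).
  split; [comp_tac|]. intros n. rewrite HR.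
  split; intros [w Hw]; exists w; rewrite ufst_cpair, usnd_cpair in *; exact Hw.
Qed.

Lemma semi_list_ex {X} (l : list X) (R : X -> nat -> Prop) :
  (forall x, semi (R x)) -> semi (fun n => exists x, In x l /\ R x n).
Proof.
  intros H. induction l as [|x l IH].
  - apply (semi_ext (fun _ => False)); [|apply semi_const].
    intros n. split; [intros [? [[] _]]|tauto].
  - apply (semi_ext (fun n => R x n \/ exists y, In y l /\ R y n)); [|now apply semi_or].
    intros n. split.
    + intros [y [[->|Hy] Hr]]; eauto.
    + intros [Hr|[y [Hy Hr]]]; [exists x|exists y]; cbn; auto.
Qed.

Lemma semi_list_all {X} (l : list X) (R : X -> nat -> Prop) :
  (forall x, semi (R x)) -> semi (fun n => forall x, In x l -> R x n).
Proof.
  intros H. induction l as [|x l IH].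
  - apply (semi_ext (fun _ => True)); [|apply semi_const]. cbn. tauto.
  - apply (semi_ext (fun n => R x n /\ forall y, In y l -> R y n)); [|now apply semi_and].
    intros n. cbn. split.
    + intros Hn. split; auto.
    + intros [Hx Hl] y [<-|Hy]; auto.
Qed.

(** * Inductively generated predicates *)

(** The common shape of the recursive predicates on codes below. Two premises suffice: a list of
    goals needs one for its first element and one for its tail. A rule with one premise repeats
    it. *)
Inductive gen (A : nat -> Prop) (B : nat -> nat -> nat -> Prop) : nat -> Prop :=
| gen_base n : A n -> gen A B n
| gen_step n a b : B n a b -> gen A B a -> gen A B b -> gen A B n.

(* A stack machine searches for a derivation: its state is a pair of a stream of
   choices and a stack of pending goals. *)
Definition gen_machine (fA fB : nat -> nat) (st : nat) : nat :=
  let c := usnd (ufst (ufst st)) in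
  let n := ufst (pred (usnd st)) in
  let rest := usnd (pred (usnd st)) in
  let a := ufst c in
  let b := ufst (usnd c) in
  cpair (usnd (ufst st))
    (ifz (ufst (ufst (ufst st)))
       (ifz (fA (cpair n c)) rest (usnd st))
       (ifz (fB (cpair (cpair n (cpair a b)) (usnd (usnd c))))
          (S (cpair a (S (cpair b rest)))) (usnd st))).

(** Tag [k = 0] claims that the top goal [n] is a base case, any other tag that it follows from [a]
    and [b]; the rest of [c] is the witness. A failed check uses up the choice and leaves the stack
    alone, so wrong choices never discharge a goal. *)
Lemma gen_machine_eq fA fB k c w n rest :
  let stk := S (cpair n rest) in
  let a := ufst c in
  let b := ufst (usnd c) in
  gen_machine fA fB (cpair (cpair (cpair k c) w) stk) =
  cpair w
    (ifz k (ifz (fA (cpair n c)) rest stk)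
       (ifz (fB (cpair (cpair n (cpair a b)) (usnd (usnd c))))
          (S (cpair a (S (cpair b rest)))) stk)).
Proof.
  unfold gen_machine. rewrite !usnd_cpair, !ufst_cpair.
  change (pred (S (cpair n rest))) with (cpair n rest).
  rewrite ?usnd_cpair, ?ufst_cpair. reflexivity.
Qed.

Lemma semi_gen A B :
  semi A -> semi (fun m => B (ufst m) (ufst (usnd m)) (usnd (usnd m))) ->
  semi (gen A B).
Proof.
  intros [fA [HfA HA]] [fB [HfB HB]].
  set (step := gen_machine fA fB).
  exists (fun m => usnd (Nat.iter (ufst (usnd m)) step
                     (cpair (usnd (usnd m)) (S (cpair (ufst m) 0))))).
  split.
  { assert (comp step) by (unfold step, gen_machine; comp_tac). comp_tac. }
  assert (Hcomplete : forall n, gen A B n -> forall rest w0, exists w t,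
             Nat.iter t step (cpair w (S (cpair n rest))) = cpair w0 rest).
  { induction 1 as [n Hn|n a b Hn _ IHa _ IHb]; intros rest w0.
    - apply HA in Hn as [c Hc]. exists (cpair (cpair 0 c) w0), 1.
      change (step (cpair (cpair (cpair 0 c) w0) (S (cpair n rest))) = cpair w0 rest).
      unfold step. rewrite gen_machine_eq, Hc. reflexivity.
    - destruct (IHb rest w0) as [wb [tb Hb]].
      destruct (IHa (S (cpair b rest)) wb) as [wa [ta Ha]].
      destruct (proj1 (HB (cpair n (cpair a b)))) as [w Hw].
      { now rewrite ?ufst_cpair, ?usnd_cpair, ?ufst_cpair. }
      exists (cpair (cpair 1 (cpair a (cpair b w))) wa), (tb + (ta + 1)).
      rewrite !Nat.iter_add. rewrite <- Hb, <- Ha. do 2 f_equal.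
      change (step (cpair (cpair (cpair 1 (cpair a (cpair b w))) wa) (S (cpair n rest)))
              = cpair wa (S (cpair a (S (cpair b rest))))).
      unfold step. rewrite gen_machine_eq, !usnd_cpair, !ufst_cpair, Hw. reflexivity. }
  (* A run that empties the stack certifies every goal on the initial stack. From an empty stack
     there is nothing to prove, whatever the machine does next. *)
  assert (Hsound : forall t w stk, usnd (Nat.iter t step (cpair w stk)) = 0 ->
             forall L, stk = enc_list L -> Forall (gen A B) L).
  { induction t as [|t IH]; intros w stk H L ->.
    - change (usnd (cpair w (enc_list L)) = 0) in H. rewrite usnd_cpair in H.
      destruct L; [constructor|discriminate].
    - destruct L as [|n L]; [constructor|].
      rewrite Nat.iter_succ_r, enc_list_cons in H.
      rewrite <- (cpair_unpair w), <- (cpair_unpair (ufst w)) in H.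
      unfold step at 2 in H. rewrite gen_machine_eq in H. revert H.
      destruct (ufst (ufst w)); cbn [ifz].
      + destruct (fA _) eqn:E; cbn [ifz]; intros H.
        * constructor; [|exact (IH _ _ H L eq_refl)].
          apply gen_base, HA. eauto.
        * exact (IH _ _ H (n :: L) eq_refl).
      + destruct (fB _) eqn:E; cbn [ifz]; intros H.
        * pose proof (IH _ _ H (_ :: _ :: L) eq_refl) as HL.
          inversion HL as [|a L1 Ha HL1]; subst. inversion HL1 as [|b L2 Hb HL2]; subst.
          constructor; [|exact HL2]. eapply gen_step; [|exact Ha|exact Hb].
          pose proof (proj2 (HB (cpair n (cpair (ufst (usnd (ufst w)))
                                            (ufst (usnd (usnd (ufst w)))))))) as Hn.
          rewrite ?ufst_cpair, ?usnd_cpair, ?ufst_cpair in Hn. eauto.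
        * exact (IH _ _ H (n :: L) eq_refl). }
  intros n. split.
  - intros Hn. destruct (Hcomplete n Hn 0 0) as [w [t Ht]].
    exists (cpair t w). rewrite ?ufst_cpair, ?usnd_cpair, ?ufst_cpair, Ht.
    apply usnd_cpair.
  - intros [w Hw]. rewrite ?ufst_cpair, ?usnd_cpair in Hw.
    specialize (Hsound _ _ _ Hw [n] eq_refl). now inversion Hsound.
Qed.

(** The bounded quantifier is generated from 0 upwards: [cpair n k] is derivable exactly when
    [R n x] holds for all [x <= k]. This collects the witnesses for all [x] in one derivation. *)
Lemma semi_ball (R : nat -> nat -> Prop) f :
  semi (fun m => R (ufst m) (usnd m)) -> comp f ->
  semi (fun n => forall x, x <= f n -> R n x).
Proof.
  intros HR Hf.
  set (A m := usnd m = 0 /\ R (ufst m) (usnd m)).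
  set (B m a b := m = cpair (ufst a) (S (usnd a)) /\ a = b /\ R (ufst m) (usnd m)).
  apply (semi_ext (fun n => gen A B (cpair n (f n)))).
  2:{ apply (semi_comp (gen A B)); [|comp_tac]. apply semi_gen.
      - apply semi_and; [apply semi_eq; comp_tac|exact HR].
      - apply semi_and; [apply semi_eq; comp_tac|].
        apply semi_and; [apply semi_eq; comp_tac|].
        apply (semi_comp (fun m => R (ufst m) (usnd m))); [exact HR|comp_tac]. }
  intros n. split.
  - generalize (f n) as k. induction k as [|k IH]; intros H.
    + apply gen_base. split; rewrite ?ufst_cpair, ?usnd_cpair; auto.
    + apply gen_step with (cpair n k) (cpair n k); auto.
      unfold B. rewrite ?ufst_cpair, ?usnd_cpair. auto.
  - intros H. remember (cpair n (f n)) as m eqn:Em.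
    assert (Hall : forall x, x <= usnd m -> R (ufst m) x).
    { clear Em. induction H as [m [H0 Hm]|m a b [Hm [Hab HRm]] _ IH _ _]; intros x Hx.
      - replace x with (usnd m) by lia. exact Hm.
      - rewrite Hm, ?ufst_cpair, ?usnd_cpair in *.
        destruct (Nat.eq_dec x (S (usnd a))) as [->|Hne]; [exact HRm|]. apply IH. lia. }
    subst m. rewrite ufst_cpair, usnd_cpair in Hall. exact Hall.
Qed.

(** * Membership in coded lists *)

Definition ltail (l : nat) : nat := usnd (pred l).

(** An existential statement about a computable equation, hence semidecidable at sight. Since
    [ltail 0] is 0, positions beyond the end contribute no members. *)
Definition mem (c l : nat) : Prop := exists i t, Nat.iter i ltail l = S (cpair c t).

Lemma ltail_cons x L : ltail (enc_list (x :: L)) = enc_list L.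
Proof. unfold ltail. rewrite enc_list_cons. apply usnd_cpair. Qed.

Lemma iter_ltail i L : Nat.iter i ltail (enc_list L) = enc_list (skipn i L).
Proof.
  revert L. induction i as [|i IH]; intros L; [reflexivity|].
  rewrite Nat.iter_succ_r. destruct L as [|x L].
  - change (ltail (enc_list [])) with (enc_list []). rewrite IH. now rewrite !skipn_nil.
  - rewrite ltail_cons. apply IH.
Qed.

Lemma mem_enc_list c L : mem c (enc_list L) <-> In c L.
Proof.
  split.
  - intros [i [t H]]. rewrite iter_ltail in H.
    destruct (skipn i L) as [|x L'] eqn:E; [discriminate|].
    rewrite enc_list_cons in H. injection H as H. apply cpair_inj in H as [-> _].
    rewrite <- (firstn_skipn i L), E. apply in_or_app. cbn. auto.
  - intros H. apply in_split in H as [L1 [L2 ->]].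
    exists (length L1), (enc_list L2).
    rewrite iter_ltail, skipn_app, skipn_all, Nat.sub_diag. reflexivity.
Qed.

(** Lets a number found by unrestricted search be treated as a list without a test of
    well-formedness. *)
Lemma enc_list_surj n : exists L, n = enc_list L.
Proof.
  induction n as [n IH] using lt_wf_ind. destruct n as [|n].
  - exists []. reflexivity.
  - destruct (IH (usnd n)) as [L HL].
    + pose proof (cpair_ge_r (ufst n) (usnd n)). rewrite cpair_unpair in H. lia.
    + exists (ufst n :: L). rewrite enc_list_cons, <- HL, cpair_unpair. reflexivity.
Qed.

Lemma enc_list_inj L L' : enc_list L = enc_list L' -> L = L'.
Proof.
  revert L'. induction L as [|x L IH]; intros [|y L'] H; try discriminate; [reflexivity|].
  rewrite !enc_list_cons in H. injection H as H. apply cpair_inj in H as [-> H].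
  f_equal. auto.
Qed.

Lemma enc_list_length L : length L <= enc_list L.
Proof.
  induction L as [|x L IH]; [cbn; lia|]. rewrite enc_list_cons. cbn.
  pose proof (cpair_ge_r x (enc_list L)). lia.
Qed.

Lemma comp_ltail f : comp f -> comp (fun n => ltail (f n)).
Proof. intros H. unfold ltail. comp_tac. Qed.

Lemma semi_mem f g : comp f -> comp g -> semi (fun n => mem (f n) (g n)).
Proof.
  intros Hf Hg. unfold mem. apply semi_ex. apply semi_ex.
  assert (comp ltail) by (apply comp_ltail, comp_id).
  apply semi_eq; comp_tac.
Qed.

(** A list is no longer than its code, so it is enough to inspect the positions up to [g n]; this
    turns the quantifier over members into a bounded one. *)
Lemma semi_all_mem (R : nat -> nat -> Prop) g :
  semi (fun m => R (ufst m) (usnd m)) -> comp g ->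
  semi (fun n => forall c, mem c (g n) -> R n c).
Proof.
  intros HR Hg. assert (comp ltail) by (apply comp_ltail, comp_id).
  apply (semi_ext (fun n => forall i, i <= g n ->
           Nat.iter i ltail (g n) = 0 \/ R n (ufst (pred (Nat.iter i ltail (g n)))))).
  2:{ apply semi_ball; [|exact Hg].
      apply semi_or; [apply semi_eq; comp_tac|].
      apply (semi_ext (fun m => (fun p => R (ufst p) (usnd p))
               (cpair (ufst m) (ufst (pred (Nat.iter (usnd m) ltail (g (ufst m)))))))).
      - intros m. now rewrite ufst_cpair, usnd_cpair.
      - apply (semi_comp (fun p => R (ufst p) (usnd p))); [exact HR|comp_tac]. }
  intros n. split.
  - intros Hall i _. destruct (Nat.iter i ltail (g n)) as [|p] eqn:E; [auto|right].
    apply Hall. exists i, (usnd p). cbn [pred]. now rewrite cpair_unpair.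
  - intros Hall c [i [t Hi]]. destruct (Hall i) as [H0|HRn].
    + destruct (enc_list_surj (g n)) as [L HL]. rewrite HL in *.
      pose proof (enc_list_length L). rewrite iter_ltail in Hi.
      destruct (le_lt_dec (length L) i) as [Hle|]; [|lia].
      rewrite skipn_all2 in Hi by exact Hle. discriminate.
    + congruence.
    + rewrite Hi in HRn. cbn [pred] in HRn. now rewrite ufst_cpair in HRn.
Qed.

(** * Terms, codes and supports *)

Lemma in_enc_list_le x L : In x L -> x <= enc_list L.
Proof.
  induction L as [|y L IH]; intros H; [destruct H|]. rewrite enc_list_cons.
  pose proof (cpair_ge_l y (enc_list L)). pose proof (cpair_ge_r y (enc_list L)).
  destruct H as [->|H]; [lia|]. specialize (IH H). lia.
Qed.

Lemma term_nested_ind (Q : term -> Prop) :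
  (forall x, Q (Var x)) -> (forall f ts, Forall Q ts -> Q (Fn f ts)) -> forall t, Q t.
Proof.
  intros Hv Hf. fix IH 1. intros [x|f ts]; [apply Hv|].
  apply Hf. induction ts as [|t ts IHts]; constructor; [apply IH|exact IHts].
Qed.

Lemma map_inj_Forall {X Y} (f : X -> Y) (l l' : list X) :
  Forall (fun x => forall x', f x = f x' -> x = x') l -> map f l = map f l' -> l = l'.
Proof.
  intros H. revert l'. induction H as [|x l Hx _ IH]; intros [|x' l'] E;
    try discriminate; [reflexivity|].
  injection E as E1 E2. f_equal; auto.
Qed.

Lemma enc_term_inj t t' : enc_term t = enc_term t' -> t = t'.
Proof.
  revert t'. induction t as [x|f ts IH] using term_nested_ind; intros [x'|f' ts'] E;
    apply cpair_inj in E as [E1 E]; try discriminate.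
  - congruence.
  - apply cpair_inj in E as [-> E]. f_equal. apply enc_list_inj in E.
    exact (map_inj_Forall _ _ _ IH E).
Qed.

Lemma enc_atom_inj A A' : enc_atom A = enc_atom A' -> A = A'.
Proof.
  destruct A as [p l], A' as [p' l']. intros E. apply cpair_inj in E as [E1 E].
  cbn in E1. subst p'. f_equal. apply enc_list_inj in E.
  refine (map_inj_Forall _ _ _ _ E). apply Forall_forall. intros t _.
  apply enc_term_inj.
Qed.

Lemma Forall_and_iff {X} (Q R : X -> Prop) l :
  Forall (fun x => Q x /\ R x) l <-> Forall Q l /\ Forall R l.
Proof. rewrite !Forall_forall. firstorder. Qed.

Definition good (Sg : signature) (t : term) : Prop := term_over Sg t /\ ground_term t.

Definition agood (Sg : signature) (A : atom) : Prop := Forall (good Sg) (aargs A).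

Lemma term_over_Fn Sg f ts :
  term_over Sg (Fn f ts) <-> In (f, length ts) Sg /\ Forall (term_over Sg) ts.
Proof.
  cbn. apply and_iff_compat_l. induction ts as [|t ts IH].
  - split; auto.
  - rewrite IH, Forall_cons_iff. reflexivity.
Qed.

Lemma ground_term_Fn f ts : ground_term (Fn f ts) <-> Forall ground_term ts.
Proof.
  cbn. induction ts as [|t ts IH].
  - split; auto.
  - rewrite IH, Forall_cons_iff. reflexivity.
Qed.

Lemma good_Fn Sg f ts :
  good Sg (Fn f ts) <-> In (f, length ts) Sg /\ Forall (good Sg) ts.
Proof.
  unfold good at 1. rewrite term_over_Fn, ground_term_Fn.
  unfold good. rewrite Forall_and_iff. tauto.
Qed.

Lemma agood_iff Sg A : agood Sg A <-> atom_over Sg A /\ ground_atom A.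
Proof. unfold agood, good. apply Forall_and_iff. Qed.

Inductive tocc (x : nat) : term -> Prop :=
| tocc_Var : tocc x (Var x)
| tocc_Fn f ts t : In t ts -> tocc x t -> tocc x (Fn f ts).

Definition aocc (x : nat) (A : atom) : Prop := exists t, In t (aargs A) /\ tocc x t.

Lemma tsubst_ext s s' t :
  (forall x, tocc x t -> s x = s' x) -> tsubst s t = tsubst s' t.
Proof.
  induction t as [x|f ts IH] using term_nested_ind; intros H.
  - apply H. constructor.
  - cbn. f_equal. apply map_ext_in. intros t Ht. rewrite Forall_forall in IH.
    apply IH; [exact Ht|]. intros x Hx. apply H. econstructor; eauto.
Qed.

Lemma asubst_ext s s' A :
  (forall x, aocc x A -> s x = s' x) -> asubst s A = asubst s' A.
Proof.
  intros H. unfold asubst. f_equal. apply map_ext_in. intros t Ht.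
  apply tsubst_ext. intros x Hx. apply H. exists t. auto.
Qed.

Lemma ground_no_tocc x t : ground_term t -> ~ tocc x t.
Proof.
  intros Hg Ho. induction Ho as [|f ts t Ht _ IH]; [exact Hg|].
  apply ground_term_Fn in Hg. rewrite Forall_forall in Hg. auto.
Qed.

Lemma ground_no_aocc x A : ground_atom A -> ~ aocc x A.
Proof.
  intros Hg [t [Ht Ho]]. unfold ground_atom in Hg. rewrite Forall_forall in Hg.
  exact (ground_no_tocc x t (Hg t Ht) Ho).
Qed.

Lemma tsubst_Var t : tsubst Var t = t.
Proof.
  induction t as [x|f ts IH] using term_nested_ind; [reflexivity|].
  cbn. f_equal. induction IH as [|t ts Ht _ IH]; cbn; congruence.
Qed.

Lemma asubst_ground s A : ground_atom A -> asubst s A = A.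
Proof.
  intros HA. rewrite (asubst_ext s Var).
  - destruct A as [p l]. unfold asubst. cbn. f_equal.
    rewrite <- (map_id l) at 2. apply map_ext, tsubst_Var.
  - intros x Hx. destruct (ground_no_aocc x A HA Hx).
Qed.

Lemma good_tsubst Sg s t :
  term_over Sg t -> (forall x, tocc x t -> good Sg (s x)) -> good Sg (tsubst s t).
Proof.
  induction t as [x|f ts IH] using term_nested_ind; intros Ht Hs.
  - apply Hs. constructor.
  - apply term_over_Fn in Ht as [Hf Ht]. cbn [tsubst]. apply good_Fn.
    rewrite length_map. split; [exact Hf|].
    apply Forall_map, Forall_forall. intros t Hin. rewrite Forall_forall in IH, Ht.
    apply IH; auto. intros x Hx. apply Hs. econstructor; eauto.
Qed.

Lemma agood_asubst Sg s A :
  atom_over Sg A -> (forall x, aocc x A -> good Sg (s x)) -> agood Sg (asubst s A).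
Proof.
  intros HA Hs. unfold agood, asubst. cbn. apply Forall_map, Forall_forall. intros t Ht.
  unfold atom_over in HA. rewrite Forall_forall in HA. apply good_tsubst; auto.
  intros x Hx. apply Hs. exists t. auto.
Qed.

Fixpoint tbound (t : term) : nat :=
  match t with
  | Var x => S x
  | Fn _ ts => list_max (map tbound ts)
  end.

Definition abound (A : atom) : nat := list_max (map tbound (aargs A)).

Lemma in_list_max x l : In x l -> x <= list_max l.
Proof.
  intros H. pose proof (proj1 (list_max_le l (list_max l)) (le_n _)) as Hl.
  rewrite Forall_forall in Hl. auto.
Qed.

Lemma tocc_tbound x t : tocc x t -> x < tbound t.
Proof.
  induction 1 as [|f ts t Ht _ IH]; cbn; [lia|].
  pose proof (in_list_max _ _ (in_map tbound _ _ Ht)). lia.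
Qed.

Lemma aocc_abound x A : aocc x A -> x < abound A.
Proof.
  intros [t [Ht Ho]]. apply tocc_tbound in Ho. unfold abound.
  pose proof (in_list_max _ _ (in_map tbound _ _ Ht)). lia.
Qed.

(* Codes of instances: variables are replaced by arbitrary numbers, which need not
   be codes of terms. *)
Fixpoint evt (v : nat -> nat) (t : term) : nat :=
  match t with
  | Var x => v x
  | Fn f ts => cpair 1 (cpair f (enc_list (map (evt v) ts)))
  end.

Definition eva (v : nat -> nat) (A : atom) : nat :=
  cpair (apred A) (enc_list (map (evt v) (aargs A))).

Lemma evt_tsubst v s t :
  (forall x, tocc x t -> v x = enc_term (s x)) -> evt v t = enc_term (tsubst s t).
Proof.
  induction t as [x|f ts IH] using term_nested_ind; intros H.
  - apply H. constructor.
  - cbn [evt tsubst enc_term]. do 3 f_equal. rewrite map_map. apply map_ext_in.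
    intros t Ht. rewrite Forall_forall in IH. apply IH; [exact Ht|].
    intros x Hx. apply H. econstructor; eauto.
Qed.

Lemma eva_asubst v s A :
  (forall x, aocc x A -> v x = enc_term (s x)) -> eva v A = enc_atom (asubst s A).
Proof.
  intros H. unfold eva, enc_atom, asubst. cbn [apred aargs]. do 2 f_equal.
  rewrite map_map. apply map_ext_in.
  intros t Ht. apply evt_tsubst. intros x Hx. apply H. exists t. auto.
Qed.

Lemma map_eq_in {X Y Z} (f : X -> Z) (g : Y -> Z) l l' x :
  map f l = map g l' -> In x l -> exists y, In y l' /\ f x = g y.
Proof.
  intros E Hx. apply (in_map f) in Hx. rewrite E in Hx.
  apply in_map_iff in Hx as [y [Hy Hin]]. eauto.
Qed.

(** Matching on codes: if the pattern [h] evaluates to the code of a good term, the numbers assigned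
    to its variables must themselves code good terms. So comparing head codes also validates the
    environment at the head variables. *)
Lemma evt_inv Sg v h x : tocc x h -> forall t, good Sg t -> evt v h = enc_term t ->
  exists u, good Sg u /\ v x = enc_term u.
Proof.
  induction 1 as [|f ts h Hh _ IH]; intros t Ht E; [eauto|].
  destruct t as [y|g us]; apply cpair_inj in E as [E1 E]; [discriminate|].
  apply cpair_inj in E as [_ E]. apply enc_list_inj in E.
  apply good_Fn in Ht as [_ Ht]. rewrite Forall_forall in Ht.
  destruct (map_eq_in _ _ _ _ _ E Hh) as [u [Hu Eu]]. eauto.
Qed.

Lemma eva_inv Sg v A x B : aocc x A -> agood Sg B -> eva v A = enc_atom B ->
  exists u, good Sg u /\ v x = enc_term u.
Proof.
  intros [t [Ht Ho]] HB E. apply cpair_inj in E as [_ E]. apply enc_list_inj in E.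
  destruct (map_eq_in _ _ _ _ _ E Ht) as [u [Hu Eu]].
  unfold agood in HB. rewrite Forall_forall in HB.
  exact (evt_inv Sg v t x Ho u (HB u Hu) Eu).
Qed.

Lemma evt_ge v t x : tocc x t -> v x <= evt v t.
Proof.
  induction 1 as [|f ts t Ht _ IH]; [apply le_n|]. cbn [evt].
  pose proof (in_enc_list_le _ _ (in_map (evt v) _ _ Ht)).
  pose proof (cpair_ge_r f (enc_list (map (evt v) ts))).
  pose proof (cpair_ge_r 1 (cpair f (enc_list (map (evt v) ts)))). lia.
Qed.

Lemma eva_ge v A x : aocc x A -> v x <= eva v A.
Proof.
  intros [t [Ht Ho]]. apply (evt_ge v) in Ho. unfold eva.
  pose proof (in_enc_list_le _ _ (in_map (evt v) _ _ Ht)).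
  pose proof (cpair_ge_r (apred A) (enc_list (map (evt v) (aargs A)))). lia.
Qed.

(** An environment is one number read as a stream of nested pairs; every number is an environment,
    with a value at each index. *)
Definition val (e i : nat) : nat := ufst (Nat.iter i usnd e).

Fixpoint env (v : nat -> nat) (n : nat) : nat :=
  match n with
  | 0 => 0
  | S n => cpair (v 0) (env (fun i => v (S i)) n)
  end.

Lemma val_env v n i : i < n -> val (env v n) i = v i.
Proof.
  revert v i. induction n as [|n IH]; intros v i Hi; [lia|].
  unfold val. destruct i as [|i].
  - apply ufst_cpair.
  - rewrite Nat.iter_succ_r. cbn [env]. rewrite usnd_cpair. apply (IH (fun i => v (S i))). lia.
Qed.

Lemma env_mono v w n : (forall i, v i <= w i) -> env v n <= env w n.
Proof.
  revert v w. induction n as [|n IH]; intros v w H; [apply le_n|].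
  apply cpair_mono; auto.
Qed.

Lemma comp_env g n : comp g -> comp (fun b => env (fun _ => g b) n).
Proof.
  intros Hg. induction n as [|n IH]; cbn [env]; [comp_tac|].
  apply comp_cpair; [exact Hg|exact IH].
Qed.

Lemma comp_enc_list {X} (F : X -> nat -> nat) (l : list X) :
  Forall (fun x => comp (F x)) l -> comp (fun n => enc_list (map (fun x => F x n) l)).
Proof.
  induction 1 as [|x l Hx _ IH]; [exact (comp_const 0)|].
  exact (comp_S _ (comp_cpair _ _ Hx IH)).
Qed.

Lemma comp_val g i : comp g -> comp (fun n => val (g n) i).
Proof. intros Hg. unfold val. assert (comp usnd) by comp_tac. comp_tac. Qed.

Lemma comp_evt g t : comp g -> comp (fun n => evt (val (g n)) t).
Proof.
  intros Hg. induction t as [x|f ts IH] using term_nested_ind; cbn [evt].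
  - apply comp_val, Hg.
  - comp_tac. exact (comp_enc_list (fun t n => evt (val (g n)) t) ts IH).
Qed.

Lemma comp_eva g A : comp g -> comp (fun n => eva (val (g n)) A).
Proof.
  intros Hg. unfold eva. comp_tac.
  apply (comp_enc_list (fun t n => evt (val (g n)) t)).
  apply Forall_forall. intros t _. apply comp_evt, Hg.
Qed.

(** * Supports as derivation trees *)

Definition pos (G : list literal) : list atom :=
  flat_map (fun l => match l with Pos a => [a] | Neg _ => [] end) G.

Definition neg (G : list literal) : list atom :=
  flat_map (fun l => match l with Pos _ => [] | Neg a => [a] end) G.

Lemma in_pos G B : In B (pos G) <-> In (Pos B) G.
Proof.
  unfold pos. rewrite in_flat_map. split.
  - intros [[a|a] [Hl Ha]]; [|destruct Ha]. destruct Ha as [->|[]]. exact Hl.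
  - intros H. exists (Pos B). cbn. auto.
Qed.

Lemma in_neg G B : In B (neg G) <-> In (Neg B) G.
Proof.
  unfold neg. rewrite in_flat_map. split.
  - intros [[a|a] [Hl Ha]]; [destruct Ha|]. destruct Ha as [->|[]]. exact Hl.
  - intros H. exists (Neg B). cbn. auto.
Qed.

Lemma pos_app G H : pos (G ++ H) = pos G ++ pos H.
Proof. apply flat_map_app. Qed.

Lemma neg_app G H : neg (G ++ H) = neg G ++ neg H.
Proof. apply flat_map_app. Qed.

Lemma pos_lsubst s G : pos (map (lsubst s) G) = map (asubst s) (pos G).
Proof.
  induction G as [|[a|a] G IH]; [reflexivity| |exact IH]. exact (f_equal (cons _) IH).
Qed.

Lemma neg_lsubst s G : neg (map (lsubst s) G) = map (asubst s) (neg G).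
Proof.
  induction G as [|[a|a] G IH]; [reflexivity|exact IH|]. exact (f_equal (cons _) IH).
Qed.

(* [sup I G N]: resolving all of the goals [G] leaves the negated atoms [N]. *)
Inductive sup (I : rule -> Prop) : list atom -> list atom -> Prop :=
| sup_nil : sup I [] []
| sup_cons r G N1 N2 :
    I r -> sup I (pos (body r)) N1 -> sup I G N2 ->
    sup I (head r :: G) ((neg (body r) ++ N1) ++ N2).

Lemma sup_app I L1 N1 L2 N2 :
  sup I L1 N1 -> sup I L2 N2 -> sup I (L1 ++ L2) (N1 ++ N2).
Proof.
  intros H H2. induction H as [|r G M1 M2 Hr H1 _ _ IH]; [exact H2|].
  rewrite <- app_assoc. cbn. constructor; auto.
Qed.

Lemma sup_app_inv I L1 L2 N :
  sup I (L1 ++ L2) N -> exists N1 N2, N = N1 ++ N2 /\ sup I L1 N1 /\ sup I L2 N2.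
Proof.
  revert N. induction L1 as [|B L1 IH]; intros N H.
  - exists [], N. repeat split; [constructor|exact H].
  - inversion H as [|r G M1 M2 Hr H1 H2]; subst.
    destruct (IH _ H2) as [N1 [N2 [-> [Ha Hb]]]].
    exists ((neg (body r) ++ M1) ++ N1), N2.
    split; [apply app_assoc|]. split; [constructor; auto|exact Hb].
Qed.

(** The subtree of one occurrence of [B] is replaced by the given derivation and the others are
    kept. This lifts relevance of [C] from a body atom to the head of a rule. *)
Lemma sup_in I L N B M C :
  sup I L N -> In B L -> sup I [B] M -> In C M -> exists N', sup I L N' /\ In C N'.
Proof.
  intros HL HB HM HC. apply in_split in HB as [L1 [L2 ->]].
  apply sup_app_inv in HL as [N1 [N2 [_ [H1 H2]]]].
  apply (sup_app_inv I [B] L2) in H2 as [_ [N3 [_ [_ H3]]]].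
  exists (N1 ++ M ++ N3). split.
  - apply sup_app; [exact H1|]. exact (sup_app I [B] M L2 N3 HM H3).
  - rewrite !in_app_iff. auto.
Qed.

Lemma sld_context Sg P G G' H1 H2 :
  clos_refl_trans _ (sld_step Sg P) G G' ->
  clos_refl_trans _ (sld_step Sg P) (H1 ++ G ++ H2) (H1 ++ G' ++ H2).
Proof.
  induction 1 as [G G' Hs|G|G1 G2 G3 _ IH1 _ IH2].
  - apply rt_step. destruct Hs as [X [Y [B [r [-> [Hr [Hh ->]]]]]]].
    exists (H1 ++ X), (Y ++ H2), B, r. rewrite <- !app_assoc. cbn.
    rewrite <- ?app_assoc. auto.
  - apply rt_refl.
  - eapply rt_trans; eauto.
Qed.

Lemma sld_sup Sg P G G' :
  clos_refl_trans _ (sld_step Sg P) G G' -> pos G' = [] ->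
  exists N, sup (ground_instance Sg P) (pos G) N /\
            forall C, In C (neg G') <-> In C (neg G) \/ In C N.
Proof.
  (* Peeling steps off the front keeps the final goal fixed; the rule of the first step becomes the
     root of the tree for the atom it resolves. *)
  intros H HG. apply clos_rt_rt1n in H. induction H as [G|G G1 G' Hs _ IH].
  - exists []. rewrite HG. split; [constructor|]. cbn. tauto.
  - destruct (IH HG) as [N [HN Heq]].
    destruct Hs as [X [Y [B [r [-> [Hr [Hh ->]]]]]]].
    rewrite !pos_app in *. rewrite !neg_app in *.
    apply sup_app_inv in HN as [N1 [N' [-> [Ha Hb]]]].
    apply sup_app_inv in Hb as [N2 [N3 [-> [Hb Hc]]]].
    exists (N1 ++ (neg (body r) ++ N2) ++ N3). split.
    + apply sup_app; [exact Ha|]. subst B. cbn. constructor; auto.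
    + intros C. rewrite (Heq C), !in_app_iff. cbn.
      change (flat_map _ Y) with (neg Y). tauto.
Qed.

Lemma pos_cons_split G B L :
  pos G = B :: L -> exists G1 G2, G = G1 ++ Pos B :: G2 /\ pos G1 = [] /\ pos G2 = L.
Proof.
  induction G as [|[a|a] G IH]; cbn; intros H; [discriminate| |].
  - injection H as -> H. exists [], G. auto.
  - destruct (IH H) as [G1 [G2 [-> [H1 H2]]]]. exists (Neg a :: G1), G2. auto.
Qed.

(** The tree is played back from the left: each body is resolved completely before the goals to its
    right. *)
Lemma sup_sld Sg P L N :
  sup (ground_instance Sg P) L N -> forall G, pos G = L ->
  exists G', clos_refl_trans _ (sld_step Sg P) G G' /\ pos G' = [] /\
             forall C, In C (neg G') <-> In C (neg G) \/ In C N.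
Proof.
  induction 1 as [|r L N1 N2 Hr _ IH1 _ IH2]; intros G HG.
  - exists G. repeat split; [apply rt_refl|exact HG|cbn; tauto|cbn; tauto].
  - apply pos_cons_split in HG as [X [Y [-> [HX HY]]]].
    destruct (IH1 _ eq_refl) as [B' [HB [HB0 HBn]]].
    destruct (IH2 _ HY) as [Y' [HY' [HY0 HYn]]].
    exists (X ++ B' ++ Y'). split; [|split].
    + apply rt_trans with (X ++ body r ++ Y).
      { apply rt_step. exists X, Y, (head r), r. auto. }
      apply rt_trans with (X ++ B' ++ Y); [apply sld_context, HB|].
      pose proof (sld_context Sg P Y Y' (X ++ B') [] HY') as H.
      rewrite !app_nil_r, <- !app_assoc in H. exact H.
    + rewrite !pos_app, HX, HB0, HY0. reflexivity.
    + intros C. rewrite !neg_app, !in_app_iff, HBn, HYn. cbn.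
      change (flat_map _ Y) with (neg Y). tauto.
Qed.

Lemma pos_nil_iff G : pos G = [] <-> forall B, ~ In (Pos B) G.
Proof.
  split.
  - intros H B HB. apply in_pos in HB. rewrite H in HB. exact HB.
  - intros H. destruct (pos G) as [|B L] eqn:E; [reflexivity|].
    destruct (H B). apply in_pos. rewrite E. cbn. auto.
Qed.

Lemma is_support_iff Sg P A S :
  is_support Sg P A S <->
  exists N, sup (ground_instance Sg P) [A] N /\ forall C, S C <-> In C N.
Proof.
  split.
  - intros [G [Hs [HG HS]]]. apply pos_nil_iff in HG.
    destruct (sld_sup _ _ _ _ Hs HG) as [N [HN Heq]].
    exists N. split; [exact HN|]. intros C. rewrite HS, <- in_neg, Heq. cbn. tauto.
  - intros [N [HN HS]].
    destruct (sup_sld _ _ _ _ HN [Pos A] eq_refl) as [G [Hs [HG Heq]]].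
    exists G. split; [exact Hs|]. split; [apply pos_nil_iff, HG|].
    intros C. rewrite HS, <- in_neg, Heq. cbn. tauto.
Qed.

Lemma ground_counter_support_iff Sg P A K :
  ground_counter_support Sg P A K <->
  (forall B, K B -> ground_atom B) /\
  (forall N, sup (ground_instance Sg P) [A] N -> exists B, In B N /\ K B) /\
  (forall B, K B -> exists N, sup (ground_instance Sg P) [A] N /\ In B N).
Proof.
  unfold ground_counter_support. split; intros [H1 [H2 H3]]; (split; [exact H1|split]).
  - intros N HN. destruct (H2 (fun C => In C N)) as [B HB]; [|eauto].
    apply is_support_iff. exists N. split; [exact HN|]. tauto.
  - intros B HB. destruct (H3 B HB) as [S [HS HSB]].
    apply is_support_iff in HS as [N [HN Heq]]. exists N. split; [exact HN|]. now apply Heq.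
  - intros S HS. apply is_support_iff in HS as [N [HN Heq]].
    destruct (H2 N HN) as [B [HB HK]]. exists B. split; [now apply Heq|exact HK].
  - intros B HB. destruct (H3 B HB) as [N [HN HBN]].
    exists (fun C => In C N). split; [|exact HBN].
    apply is_support_iff. exists N. split; [exact HN|]. tauto.
Qed.

Lemma ground_instance_good Sg P r :
  program_over Sg P -> ground_instance Sg P r ->
  agood Sg (head r) /\ Forall (agood Sg) (pos (body r)) /\ Forall (agood Sg) (neg (body r)).
Proof.
  intros HP [r0 [s [Hr0 [Hs ->]]]]. destruct (HP r0 Hr0) as [Hh Hb].
  cbn [head body rsubst]. rewrite pos_lsubst, neg_lsubst, !Forall_map, !Forall_forall.
  assert (Hg : forall A, atom_over Sg A -> agood Sg (asubst s A))
    by (intros A HA; apply agood_asubst; [exact HA|intros x _; apply Hs]).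
  split; [auto|split]; intros A HA; apply Hg.
  - apply in_pos in HA. exact (Hb (Pos A) HA).
  - apply in_neg in HA. exact (Hb (Neg A) HA).
Qed.

Lemma sup_good Sg P L N :
  program_over Sg P -> sup (ground_instance Sg P) L N -> Forall (agood Sg) N.
Proof.
  intros HP. induction 1 as [|r G N1 N2 Hr _ IH1 _ IH2]; [constructor|].
  rewrite !Forall_app. repeat split; auto.
  now apply (ground_instance_good Sg P r).
Qed.

Lemma sup_depends Sg P L N :
  sup (ground_instance Sg P) L N ->
  forall C, In C N -> exists B, In B L /\ depends Sg P B C.
Proof.
  induction 1 as [|r G N1 N2 Hr _ IH1 _ IH2]; intros C HC; [destruct HC|].
  rewrite !in_app_iff in HC. destruct HC as [[HC|HC]|HC].
  - exists (head r). split; [now left|]. apply rt_step. exists r.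
    apply in_neg in HC. auto.
  - destruct (IH1 C HC) as [B [HB Hd]]. exists (head r). split; [now left|].
    apply rt_trans with B; [|exact Hd]. apply rt_step. exists r. apply in_pos in HB. auto.
  - destruct (IH2 C HC) as [B [HB Hd]]. exists B. cbn. auto.
Qed.

Lemma classical_filter {X} (Q : X -> Prop) (l : list X) :
  exists l', forall x, In x l' <-> In x l /\ Q x.
Proof.
  induction l as [|y l [l' IH]]; [exists []; cbn; tauto|].
  destruct (classic (Q y)) as [Hy|Hy].
  - exists (y :: l'). intros x. cbn. rewrite IH.
    split; [intros [->|]; tauto|tauto].
  - exists l'. intros x. cbn. rewrite IH.
    split; [tauto|intros [[->|] ?]; tauto].
Qed.

(** Boundedly many codes, each naming at most one object, name only finitely many objects. *)
Lemma classical_list_le {X} (R : nat -> X -> Prop) m :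
  (forall e x y, R e x -> R e y -> x = y) ->
  exists l, forall e x, e <= m -> R e x -> In x l.
Proof.
  intros HR.
  assert (H1 : forall e, exists l, forall x, R e x -> In x l).
  { intros e. destruct (classic (exists x, R e x)) as [[x Hx]|Hno].
    - exists [x]. intros y Hy. left. eauto.
    - exists []. intros x Hx. apply Hno. eauto. }
  induction m as [|m [l IH]].
  - destruct (H1 0) as [l Hl]. exists l. intros e x He Hx.
    replace e with 0 in Hx by lia. auto.
  - destruct (H1 (S m)) as [l' Hl']. exists (l' ++ l). intros e x He Hx.
    apply in_or_app. destruct (Nat.eq_dec e (S m)) as [->|]; [auto|].
    right. apply IH with e; [lia|exact Hx].
Qed.

(** * Counter-supports on codes *)

Definition head_code (r : rule) (e : nat) : nat := eva (val e) (head r).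

Definition pos_code (r : rule) (e : nat) : nat :=
  enc_list (map (eva (val e)) (pos (body r))).

Definition neg_code (r : rule) (e : nat) : nat :=
  enc_list (map (eva (val e)) (neg (body r))).

Definition atoms_code (L : list atom) : nat := enc_list (map enc_atom L).

Lemma mem_atoms_code B L : mem (enc_atom B) (atoms_code L) <-> In B L.
Proof.
  unfold atoms_code. rewrite mem_enc_list, in_map_iff. split.
  - intros [C [E HC]]. apply enc_atom_inj in E. congruence.
  - eauto.
Qed.

Lemma mem_atoms_code_inv c L : mem c (atoms_code L) -> exists B, c = enc_atom B /\ In B L.
Proof.
  unfold atoms_code. rewrite mem_enc_list, in_map_iff. intros [C [E HC]]. eauto.
Qed.

Lemma comp_head_code r g : comp g -> comp (fun n => head_code r (g n)).
Proof. apply comp_eva. Qed.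

Lemma comp_pos_code r g : comp g -> comp (fun n => pos_code r (g n)).
Proof.
  intros Hg. apply (comp_enc_list (fun B n => eva (val (g n)) B)).
  apply Forall_forall. intros B _. apply comp_eva, Hg.
Qed.

Lemma comp_neg_code r g : comp g -> comp (fun n => neg_code r (g n)).
Proof.
  intros Hg. apply (comp_enc_list (fun B n => eva (val (g n)) B)).
  apply Forall_forall. intros B _. apply comp_eva, Hg.
Qed.

Ltac comp_code_step :=
  match goal with
  | |- comp (fun n => head_code _ _) => apply comp_head_code
  | |- comp (fun n => pos_code _ _) => apply comp_pos_code
  | |- comp (fun n => neg_code _ _) => apply comp_neg_code
  | |- comp (fun n => eva (val _) _) => apply comp_eva
  | |- comp (fun n => val _ _) => apply comp_val
  end.
Ltac comp_code_tac := repeat first [comp_step | comp_code_step].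

(** Then the rule and the code of its head instance determine the whole ground instance, so the
    instances with a given head can be found by bounded search. *)
Definition safe (P : program) : Prop :=
  forall r B x, In r P -> In B (pos (body r)) \/ In B (neg (body r)) ->
    aocc x B -> aocc x (head r).

Lemma functional_choice_exists {X} (Q : nat -> X -> Prop) :
  (forall i, exists x, Q i x) -> exists s, forall i, Q i (s i).
Proof.
  intros H. exists (fun i => proj1_sig (constructive_indefinite_description _ (H i))).
  intros i. apply (proj2_sig (constructive_indefinite_description _ (H i))).
Qed.

Lemma eva_body v s L :
  (forall B x, In B L -> aocc x B -> v x = enc_term (s x)) ->
  enc_list (map (eva v) L) = atoms_code (map (asubst s) L).
Proof.
  intros H. unfold atoms_code. f_equal. rewrite map_map. apply map_ext_in.
  intros B HB. apply eva_asubst. eauto.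
Qed.

(** Matching makes [e] a good substitution on the head variables. Elsewhere [e] may hold junk; there
    [t0] is substituted instead, and by safety the body does not see the difference. *)
Lemma code_instance Sg P r e B :
  (exists t, good Sg t) -> safe P -> In r P -> agood Sg B ->
  head_code r e = enc_atom B ->
  exists r', ground_instance Sg P r' /\ head r' = B /\
    pos_code r e = atoms_code (pos (body r')) /\
    neg_code r e = atoms_code (neg (body r')).
Proof.
  intros [t0 Ht0] HS Hr HB E.
  destruct (functional_choice_exists (fun x t =>
              good Sg t /\ (aocc x (head r) -> val e x = enc_term t))) as [s Hs].
  { intros x. destruct (classic (aocc x (head r))) as [Hx|Hx].
    - destruct (eva_inv Sg (val e) (head r) x B Hx HB E) as [t [Ht Et]]. eauto.
    - exists t0. tauto. }
  exists (rsubst s r). split; [|split; [|split]].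
  - exists r, s. split; [exact Hr|]. split; [|reflexivity]. intros x. apply Hs.
  - apply enc_atom_inj. rewrite <- E. symmetry. apply eva_asubst. intros x Hx. now apply Hs.
  - cbn [rsubst body]. rewrite pos_lsubst. apply eva_body.
    intros C x HC Hx. apply Hs. eauto.
  - cbn [rsubst body]. rewrite neg_lsubst. apply eva_body.
    intros C x HC Hx. apply Hs. eauto.
Qed.

(** By [env_mono], an upper bound for the codes built by [env] from [m] entries that are at most
    [b]. *)
Definition env_bound (m b : nat) : nat := env (fun _ => b) m.

Definition heads_bound (P : program) : nat := list_max (map (fun r => abound (head r)) P).

(** The terms substituted for head variables are subterms of the head instance, so their codes do
    not exceed its code. This is the origin of the bound on [e]; [heads_bound] makes it uniform over
    the rules. *)
Lemma instance_code Sg P r' :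
  safe P -> ground_instance Sg P r' ->
  exists r, In r P /\ exists e, e <= env_bound (heads_bound P) (enc_atom (head r')) /\
    head_code r e = enc_atom (head r') /\
    pos_code r e = atoms_code (pos (body r')) /\
    neg_code r e = atoms_code (neg (body r')).
Proof.
  intros HS [r [s [Hr [_ ->]]]]. exists r. split; [exact Hr|].
  cbn [rsubst head body]. rewrite pos_lsubst, neg_lsubst.
  set (b := enc_atom (asubst s (head r))).
  (* The minimum only matters at variables that do not occur in the rule. *)
  set (e := env (fun x => Nat.min (enc_term (s x)) b) (heads_bound P)).
  assert (Hval : forall x, aocc x (head r) -> val e x = enc_term (s x)).
  { intros x Hx. unfold e. rewrite val_env.
    - apply Nat.min_l. unfold b.
      rewrite <- (eva_asubst (fun x => enc_term (s x)) s (head r)) by reflexivity.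
      exact (eva_ge (fun x => enc_term (s x)) (head r) x Hx).
    - apply aocc_abound in Hx. unfold heads_bound.
      pose proof (in_list_max _ _ (in_map (fun r => abound (head r)) _ _ Hr)). cbn in *. lia. }
  exists e. split; [|split; [|split]].
  - apply env_mono. intros x. lia.
  - apply eva_asubst, Hval.
  - apply eva_body. eauto.
  - apply eva_body. eauto.
Qed.

(** Codes of goal lists that have a support: of the two premises, [a] is the remaining list and [b]
    the positive body of a rule for the first goal. *)
Definition supp_code (P : program) : nat -> Prop :=
  gen (fun n => n = 0)
    (fun n a b => exists r, In r P /\
       exists e, n = S (cpair (head_code r e) a) /\ b = pos_code r e).

Lemma semi_supp_code P : semi (supp_code P).
Proof.
  apply semi_gen; [apply semi_eq; comp_tac|].
  apply (semi_list_ex P (fun r m => exists e,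
           ufst m = S (cpair (head_code r e) (ufst (usnd m))) /\
           usnd (usnd m) = pos_code r e)).
  intros r. apply semi_ex. apply semi_and; apply semi_eq; comp_code_tac.
Qed.

Lemma supp_code_iff Sg P :
  (exists t, good Sg t) -> safe P -> program_over Sg P -> forall L,
  Forall (agood Sg) L -> supp_code P (atoms_code L) <-> exists N, sup (ground_instance Sg P) L N.
Proof.
  intros Hne HS HP L HL. split.
  - intros H. remember (atoms_code L) as n eqn:En. revert L HL En.
    induction H as [n ->|n a b [r [Hr [e [Hn Hb]]]] _ IHa _ IHb]; intros L HL En.
    + destruct L; [|discriminate]. exists []. constructor.
    + destruct L as [|B L]; [subst n; discriminate|].
      subst n. change (atoms_code (B :: L)) with (S (cpair (enc_atom B) (atoms_code L))) in En.
      injection En as En. apply cpair_inj in En as [En ->].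
      inversion HL as [|? ? HB HL']; subst.
      destruct (code_instance Sg P r e B Hne HS Hr HB En) as [r' [Hr' [<- [Ep _]]]].
      destruct (IHa L HL' eq_refl) as [N2 H2].
      destruct (IHb _ (proj1 (proj2 (ground_instance_good Sg P r' HP Hr'))) Ep) as [N1 H1].
      exists ((neg (body r') ++ N1) ++ N2). constructor; auto.
  - intros [N H]. clear HL. induction H as [|r G N1 N2 Hr _ IH1 _ IH2].
    + apply gen_base. reflexivity.
    + destruct (instance_code Sg P r HS Hr) as [r0 [Hr0 [e [_ [Eh [Ep _]]]]]].
      apply gen_step with (atoms_code G) (atoms_code (pos (body r))); auto.
      exists r0. split; [exact Hr0|]. exists e. rewrite Eh. auto.
Qed.

(** Pairs of an atom and a member of one of its supports. Requiring [supp_code] of the whole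
    positive body ensures that the partial derivation leading to the member can be completed to a
    support. *)
Definition rel_code (P : program) : nat -> Prop :=
  gen (fun n => exists r, In r P /\ exists e, head_code r e = ufst n /\
         supp_code P (pos_code r e) /\ mem (usnd n) (neg_code r e))
    (fun n a b => exists r, In r P /\ exists e, head_code r e = ufst n /\
         supp_code P (pos_code r e) /\ mem (ufst a) (pos_code r e) /\
         usnd a = usnd n /\ a = b).

Lemma semi_rel_code P : semi (rel_code P).
Proof.
  apply semi_gen.
  - apply (semi_list_ex P (fun r n => exists e, head_code r e = ufst n /\
         supp_code P (pos_code r e) /\ mem (usnd n) (neg_code r e))).
    intros r. apply semi_ex.
    apply semi_and; [apply semi_eq; comp_code_tac|].
    apply semi_and; [apply (semi_comp (supp_code P)); [apply semi_supp_code|comp_code_tac]|].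
    apply semi_mem; comp_code_tac.
  - apply (semi_list_ex P (fun r n => exists e, head_code r e = ufst (ufst n) /\
         supp_code P (pos_code r e) /\ mem (ufst (ufst (usnd n))) (pos_code r e) /\
         usnd (ufst (usnd n)) = usnd (ufst n) /\ ufst (usnd n) = usnd (usnd n))).
    intros r. apply semi_ex.
    apply semi_and; [apply semi_eq; comp_code_tac|].
    apply semi_and; [apply (semi_comp (supp_code P)); [apply semi_supp_code|comp_code_tac]|].
    apply semi_and; [apply semi_mem; comp_code_tac|].
    apply semi_and; apply semi_eq; comp_code_tac.
Qed.

Lemma rel_code_sound Sg P n :
  (exists t, good Sg t) -> safe P -> program_over Sg P ->
  rel_code P n -> forall B, agood Sg B -> ufst n = enc_atom B ->
  exists C N, usnd n = enc_atom C /\ sup (ground_instance Sg P) [B] N /\ In C N.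
Proof.
  intros Hne HS HP.
  induction 1 as [n [r [Hr [e [Eh [Hsupp Hmem]]]]]
                 |n a b [r [Hr [e [Eh [Hsupp [Hmem [Ec _]]]]]]] _ IH _ _]; intros B HB En;
    rewrite En in Eh;
    destruct (code_instance Sg P r e B Hne HS Hr HB Eh) as [r' [Hr' [<- [Ep Eg]]]];
    pose proof (ground_instance_good Sg P r' HP Hr') as [_ [Hgp _]];
    rewrite Ep in Hsupp;
    apply (supp_code_iff Sg P Hne HS HP _ Hgp) in Hsupp as [N1 H1].
  - rewrite Eg in Hmem. apply mem_atoms_code_inv in Hmem as [C [EC HC]].
    exists C, ((neg (body r') ++ N1) ++ []). split; [exact EC|]. split.
    + constructor; [exact Hr'|exact H1|constructor].
    + rewrite !in_app_iff. auto.
  - rewrite Ep in Hmem. apply mem_atoms_code_inv in Hmem as [B' [EB' HB']].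
    rewrite Forall_forall in Hgp.
    destruct (IH B' (Hgp B' HB') EB') as [C [M [EC [HM HCM]]]].
    destruct (sup_in _ _ _ _ _ _ H1 HB' HM HCM) as [N' [HN' HCN']].
    exists C, ((neg (body r') ++ N') ++ []). split; [congruence|]. split.
    + constructor; [exact Hr'|exact HN'|constructor].
    + rewrite !in_app_iff. auto.
Qed.

Lemma rel_code_complete Sg P L N :
  (exists t, good Sg t) -> safe P -> program_over Sg P ->
  sup (ground_instance Sg P) L N -> forall C, In C N ->
  exists B, In B L /\ rel_code P (cpair (enc_atom B) (enc_atom C)).
Proof.
  intros Hne HS HP.
  induction 1 as [|r G N1 N2 Hr H1 IH1 _ IH2]; intros C HC; [destruct HC|].
  pose proof (ground_instance_good Sg P r HP Hr) as [_ [Hgp _]].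
  assert (Hsupp : supp_code P (atoms_code (pos (body r))))
    by (apply (supp_code_iff Sg P Hne HS HP _ Hgp); eauto).
  destruct (instance_code Sg P r HS Hr) as [r0 [Hr0 [e [_ [Eh [Ep Eg]]]]]].
  rewrite !in_app_iff in HC. destruct HC as [[HC|HC]|HC].
  - exists (head r). split; [now left|]. apply gen_base. exists r0. split; [exact Hr0|].
    exists e. rewrite ufst_cpair, usnd_cpair, Ep, Eg.
    repeat split; [exact Eh|exact Hsupp|]. now apply mem_atoms_code.
  - destruct (IH1 C HC) as [B [HB Hrel]]. exists (head r). split; [now left|].
    eapply gen_step; [|exact Hrel|exact Hrel]. exists r0. split; [exact Hr0|].
    exists e. rewrite !ufst_cpair, !usnd_cpair, Ep.
    repeat split; [exact Eh|exact Hsupp|]. now apply mem_atoms_code.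
  - destruct (IH2 C HC) as [B [HB Hrel]]. exists B. cbn. auto.
Qed.

(* [u] lists atoms all of whose supports meet [k]. *)
Definition blocked (P : program) (b k u : nat) : Prop :=
  forall e, e <= env_bound (heads_bound P) b -> forall r, In r P ->
    head_code r e <> b \/
    (exists c, mem c (neg_code r e) /\ mem c k) \/
    (exists c, mem c (pos_code r e) /\ mem c u).

Lemma semi_blocked P : semi (fun m => blocked P (ufst m) (ufst (usnd m)) (usnd (usnd m))).
Proof.
  apply semi_ball.
  - apply (semi_list_all P (fun r p =>
      head_code r (usnd p) <> ufst (ufst p) \/
      (exists c, mem c (neg_code r (usnd p)) /\ mem c (ufst (usnd (ufst p)))) \/
      (exists c, mem c (pos_code r (usnd p)) /\ mem c (usnd (usnd (ufst p)))))).
    intros r. apply semi_or; [apply semi_ne; comp_code_tac|].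
    apply semi_or; apply semi_ex; apply semi_and; apply semi_mem; comp_code_tac.
  - apply (comp_env (fun m => ufst m)). comp_tac.
Qed.

(** Induction on the tree: the rule used for an atom of [u] either contributes an element of [K] or
    has a positive body atom in [u], whose subtree is smaller. *)
Lemma blocked_sound Sg P K u :
  safe P -> (forall b, mem b u -> blocked P b (atoms_code K) u) ->
  forall L N, sup (ground_instance Sg P) L N ->
  forall B, In B L -> mem (enc_atom B) u -> exists C, In C N /\ In C K.
Proof.
  intros HS Hu. induction 1 as [|r G N1 N2 Hr _ IH1 _ IH2]; intros B HB Hmem; [destruct HB|].
  destruct HB as [<-|HB].
  - destruct (instance_code Sg P r HS Hr) as [r0 [Hr0 [e [He [Eh [Ep Eg]]]]]].
    destruct (Hu _ Hmem e He r0 Hr0) as [Hn|[[c [Hc Hk]]|[c [Hc Hcu]]]]; [contradiction| |].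
    + rewrite Eg in Hc. apply mem_atoms_code_inv in Hc as [C [-> HC]].
      apply mem_atoms_code in Hk. exists C. rewrite !in_app_iff. auto.
    + rewrite Ep in Hc. apply mem_atoms_code_inv in Hc as [C [-> HC]].
      destruct (IH1 C HC Hcu) as [D [HD HDK]]. exists D. rewrite !in_app_iff. auto.
  - destruct (IH2 B HB Hmem) as [D [HD HDK]]. exists D. rewrite in_app_iff. auto.
Qed.

(** Derivations of different goals can be chosen independently. By contraposition, if a list cannot
    avoid [K], then already one of its members cannot. *)
Lemma sup_avoiding I K L :
  (forall B, In B L -> exists N, sup I [B] N /\ forall C, In C N -> ~ In C K) ->
  exists N, sup I L N /\ forall C, In C N -> ~ In C K.
Proof.
  induction L as [|B L IH]; intros H.
  - exists []. split; [constructor|auto].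
  - destruct (H B) as [N1 [H1 HK1]]; [now left|].
    destruct IH as [N2 [H2 HK2]]; [intros B' HB'; apply H; now right|].
    exists (N1 ++ N2). split; [exact (sup_app I [B] N1 L N2 H1 H2)|].
    intros C HC. apply in_app_or in HC as [HC|HC]; auto.
Qed.

Lemma blocked_complete Sg P K B0 :
  (exists t, good Sg t) -> safe P -> program_over Sg P -> finitely_recursive Sg P ->
  agood Sg B0 ->
  (forall N, sup (ground_instance Sg P) [B0] N -> exists C, In C N /\ In C K) ->
  exists u, mem (enc_atom B0) u /\ forall b, mem b u -> blocked P b (atoms_code K) u.
Proof.
  intros Hne HS HP HF HB0 Hun.
  set (un B := forall N, sup (ground_instance Sg P) [B] N -> exists C, In C N /\ In C K).
  destruct (HF B0) as [l Hl]; [now apply agood_iff in HB0..|].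
  destruct (classical_filter (fun B => agood Sg B /\ depends Sg P B0 B /\ un B) l) as [U HU].
  exists (atoms_code U). split.
  { apply mem_atoms_code, HU. assert (depends Sg P B0 B0) by apply rt_refl. auto. }
  intros b Hb e _ r Hr. apply mem_atoms_code_inv in Hb as [B [-> HB]].
  apply HU in HB as [_ [HgB [HdB HunB]]].
  destruct (Nat.eq_dec (head_code r e) (enc_atom B)) as [Eh|]; [right|now left].
  destruct (code_instance Sg P r e B Hne HS Hr HgB Eh) as [r' [Hr' [Hh [Ep Eg]]]].
  pose proof (ground_instance_good Sg P r' HP Hr') as [_ [Hgp _]].
  rewrite Ep, Eg. apply NNPP. intros Hno.
  (* If no positive body atom lies in [U], each has a support avoiding [K]. Joined to a negative
     body that misses [K], these form a support of [B] avoiding [K], which contradicts [HunB]. *)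
  assert (Hav : forall C, In C (pos (body r')) ->
            exists N, sup (ground_instance Sg P) [C] N /\ forall D, In D N -> ~ In D K).
  { intros C HC. apply NNPP. intros Hav. apply Hno. right. exists (enc_atom C).
    split; [now apply mem_atoms_code|]. apply mem_atoms_code, HU.
    assert (Hd : depends Sg P B0 C).
    { apply rt_trans with B; [exact HdB|]. apply rt_step. exists r'.
      apply in_pos in HC. auto. }
    rewrite Forall_forall in Hgp.
    split; [auto|]. split; [auto|]. split; [exact Hd|].
    intros N HN. apply NNPP. intros HnoC. apply Hav. exists N. split; [exact HN|].
    intros D HD HDK. apply HnoC. eauto. }
  apply sup_avoiding in Hav as [N [HN HNK]].
  destruct (HunB ((neg (body r') ++ N) ++ [])) as [C [HC HCK]].
  { rewrite <- Hh. constructor; [exact Hr'|exact HN|constructor]. }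
  rewrite !in_app_iff in HC. destruct HC as [[HC|HC]|[]].
  - apply Hno. left. exists (enc_atom C). split; now apply mem_atoms_code.
  - exact (HNK C HC HCK).
Qed.

(** The first conjunct expresses condition (2) of a counter-support; the second replaces the
    universal condition (1) by its certificate [u]. *)
Definition counter_support_code (P : program) (b k : nat) : Prop :=
  (forall c, mem c k -> rel_code P (cpair b c)) /\
  exists u, mem b u /\ forall b', mem b' u -> blocked P b' k u.

Lemma semi_counter_support_code P f g :
  comp f -> comp g -> semi (fun n => counter_support_code P (f n) (g n)).
Proof.
  intros Hf Hg. apply semi_and.
  - apply (semi_all_mem (fun n c => rel_code P (cpair (f n) c))); [|exact Hg].
    apply (semi_comp (rel_code P)); [apply semi_rel_code|comp_tac].
  - apply semi_ex. apply semi_and; [apply semi_mem; comp_tac|].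
    apply (semi_all_mem (fun m b' => blocked P b' (g (ufst m)) (usnd m))); [|comp_tac].
    apply (semi_ext (fun p => (fun m => blocked P (ufst m) (ufst (usnd m)) (usnd (usnd m)))
             (cpair (usnd p) (cpair (g (ufst (ufst p))) (usnd (ufst p)))))).
    + intros p. now rewrite !ufst_cpair, !usnd_cpair, ufst_cpair.
    + apply (semi_comp (fun m => blocked P (ufst m) (ufst (usnd m)) (usnd (usnd m))));
        [apply semi_blocked|comp_tac].
Qed.

Lemma counter_support_code_iff Sg P B k :
  (exists t, good Sg t) -> safe P -> program_over Sg P -> finitely_recursive Sg P ->
  agood Sg B ->
  counter_support_code P (enc_atom B) k <->
  exists K, k = atoms_code K /\ ground_counter_support Sg P B (fun C => In C K).
Proof.
  intros Hne HS HP HF HB. split.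
  - intros [Hrel [u [HBu Hu]]].
    assert (H : forall c, mem c k -> exists C N,
              c = enc_atom C /\ sup (ground_instance Sg P) [B] N /\ In C N).
    { intros c Hc. destruct (rel_code_sound Sg P _ Hne HS HP (Hrel c Hc) B HB)
        as [C [N HCN]]; [apply ufst_cpair|]. rewrite usnd_cpair in HCN. eauto. }
    (* [k] is an arbitrary number, hence the code of a list of numbers; relevance makes each member
       the code of an atom. *)
    assert (HK : exists K, k = atoms_code K).
    { destruct (enc_list_surj k) as [L ->].
      assert (HL : forall c, In c L -> exists C, c = enc_atom C).
      { intros c Hc. apply mem_enc_list in Hc. destruct (H c Hc) as [C [_ [-> _]]]. eauto. }
      clear -HL. unfold atoms_code. induction L as [|c L IH]; [now exists []|].
      destruct IH as [K HK]; [intros c' Hc'; apply HL; now right|].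
      destruct (HL c) as [C ->]; [now left|].
      exists (C :: K). cbn [map]. rewrite !enc_list_cons, HK. reflexivity. }
    destruct HK as [K ->]. exists K. split; [reflexivity|].
    assert (HKs : forall C, In C K -> exists N,
              sup (ground_instance Sg P) [B] N /\ In C N).
    { intros C HC. destruct (H (enc_atom C)) as [C' [N [E HN]]]; [now apply mem_atoms_code|].
      apply enc_atom_inj in E as <-. eauto. }
    apply ground_counter_support_iff. split; [|split].
    + intros C HC. destruct (HKs C HC) as [N [HN HCN]].
      apply (sup_good Sg P _ _ HP) in HN. rewrite Forall_forall in HN.
      now apply (agood_iff Sg), HN.
    + intros N HN. exact (blocked_sound Sg P K u HS Hu _ _ HN B (or_introl eq_refl) HBu).
    + exact HKs.
  - intros [K [-> HK]]. apply ground_counter_support_iff in HK as [_ [H2 H3]]. split.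
    + intros c Hc. apply mem_atoms_code_inv in Hc as [C [-> HC]].
      destruct (H3 C HC) as [N [HN HCN]].
      destruct (rel_code_complete Sg P _ _ Hne HS HP HN C HCN) as [B' [[<-|[]] Hrel]].
      exact Hrel.
    + exact (blocked_complete Sg P K B Hne HS HP HF HB H2).
Qed.

(** Lists of terms rather than single terms are generated, so that the arguments [b] of the first
    term are again an instance of the predicate. The two [ltail] conditions say that [b] has length
    exactly [snd p]; the extra entry 0 makes this work for arity 0 too. *)
Definition ground_terms_code (Sg : signature) : nat -> Prop :=
  gen (fun n => n = 0)
    (fun n a b => exists p, In p Sg /\
       n = S (cpair (cpair 1 (cpair (fst p) b)) a) /\
       Nat.iter (snd p) ltail (S (cpair 0 b)) <> 0 /\ Nat.iter (snd p) ltail b = 0).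

Lemma semi_ground_terms_code Sg : semi (ground_terms_code Sg).
Proof.
  assert (comp ltail) by (apply comp_ltail, comp_id).
  apply semi_gen; [apply semi_eq; comp_tac|].
  apply (semi_list_ex Sg (fun p m =>
     ufst m = S (cpair (cpair 1 (cpair (fst p) (usnd (usnd m)))) (ufst (usnd m))) /\
       Nat.iter (snd p) ltail (S (cpair 0 (usnd (usnd m)))) <> 0 /\
       Nat.iter (snd p) ltail (usnd (usnd m)) = 0)).
  intros p. apply semi_and; [apply semi_eq; comp_tac|].
  apply semi_and; [apply semi_ne; comp_tac|apply semi_eq; comp_tac].
Qed.

Lemma iter_ltail_zero i L : Nat.iter i ltail (enc_list L) = 0 <-> length L <= i.
Proof.
  rewrite iter_ltail. split.
  - intros H. destruct (skipn i L) eqn:E; [|discriminate].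
    pose proof (length_skipn i L) as Hl. rewrite E in Hl. cbn in Hl. lia.
  - intros H. rewrite skipn_all2 by exact H. reflexivity.
Qed.

Lemma ground_terms_code_iff Sg L :
  ground_terms_code Sg (enc_list L) <->
  exists ts, L = map enc_term ts /\ Forall (good Sg) ts.
Proof.
  split.
  - intros H. remember (enc_list L) as n eqn:En. revert L En.
    induction H as [n ->|n a b [[f m] [Hp [Hn [H1 H2]]]] _ IHa _ IHb]; intros L En.
    + destruct L; [|discriminate]. exists []. auto.
    + destruct L as [|x L]; [subst n; discriminate|]. subst n. rewrite enc_list_cons in En.
      injection En as En. apply cpair_inj in En as [<- ->]. cbn [fst snd] in *.
      destruct (enc_list_surj b) as [M ->].
      change (S (cpair 0 (enc_list M))) with (enc_list (0 :: M)) in H1.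
      rewrite iter_ltail_zero in H1, H2. cbn in H1.
      destruct (IHa L eq_refl) as [ts [-> Hts]].
      destruct (IHb M eq_refl) as [us [-> Hus]].
      exists (Fn f us :: ts). split; [reflexivity|]. constructor; [|exact Hts].
      apply good_Fn. split; [|exact Hus]. rewrite length_map in H1, H2.
      replace (length us) with m by lia. exact Hp.
  - intros [ts [-> Hts]].
    assert (Ht : forall t, good Sg t -> forall a, ground_terms_code Sg a ->
              ground_terms_code Sg (S (cpair (enc_term t) a))).
    { clear. induction t as [x|f ts IH] using term_nested_ind; intros Hg a Ha.
      - destruct Hg as [_ []].
      - apply good_Fn in Hg as [Hf Hts].
        apply gen_step with a (enc_list (map enc_term ts)); [|exact Ha|].
        + exists (f, length ts). split; [exact Hf|]. split; [reflexivity|].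
          change (S (cpair 0 (enc_list (map enc_term ts))))
            with (enc_list (0 :: map enc_term ts)).
          cbn [snd]. rewrite !iter_ltail_zero. cbn. rewrite length_map. lia.
        + clear Hf a Ha. induction ts as [|t ts IHts]; [now apply gen_base|].
          apply Forall_cons_iff in IH as [IHt IH], Hts as [Hg Hts].
          cbn [map]. rewrite enc_list_cons. exact (IHt Hg _ (IHts IH Hts)). }
    induction Hts as [|t ts Hg _ IH]; [now apply gen_base|].
    cbn [map]. rewrite enc_list_cons. auto.
Qed.

(** * Enumerating generalized counter-supports *)

Lemma find_combine_seq e a m ts :
  map (val e) (seq a m) = map enc_term ts ->
  forall x, a <= x < a + m ->
  In (fsubst_fun (combine (seq a m) ts) x) ts /\
  val e x = enc_term (fsubst_fun (combine (seq a m) ts) x).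
Proof.
  revert a ts. induction m as [|m IH]; intros a ts E x Hx; [lia|].
  destruct ts as [|t ts]; [discriminate|]. injection E as Et E.
  unfold fsubst_fun. cbn. destruct (Nat.eqb_spec a x) as [->|Hne]; [auto|].
  destruct (IH (S a) ts E x) as [H1 H2]; [lia|]. split; [right; exact H1|exact H2].
Qed.

Lemma enc_fsubst_combine e a m ts :
  map (val e) (seq a m) = map enc_term ts ->
  enc_fsubst (combine (seq a m) ts) =
  enc_list (map (fun i => cpair i (val e i)) (seq a m)).
Proof.
  intros E. unfold enc_fsubst. f_equal. revert a ts E.
  induction m as [|m IH]; intros a ts E; [reflexivity|].
  destruct ts as [|t ts]; [discriminate|]. injection E as Et E.
  cbn. rewrite Et. f_equal. auto.
Qed.

Lemma val_env_terms ts :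
  map (val (env (fun i => enc_term (nth i ts (Var 0))) (length ts))) (seq 0 (length ts))
  = map enc_term ts.
Proof.
  transitivity (map (fun i => enc_term (nth i ts (Var 0))) (seq 0 (length ts))).
  - apply map_ext_in. intros i Hi. apply in_seq in Hi.
    exact (val_env (fun i => enc_term (nth i ts (Var 0))) (length ts) i (proj2 Hi)).
  - induction ts as [|t ts IH]; [reflexivity|]. cbn [length seq map nth]. f_equal.
    rewrite <- IH, <- seq_shift, map_map. reflexivity.
Qed.

(** The substitution has a canonical form, binding all variables below [abound A] in increasing
    order, so that its code can be computed from an environment. *)
Definition ground_counter_supports (Sg : signature) (P : program) (A : atom)
    (c : list atom * fsubst) : Prop :=
  exists ts, length ts = abound A /\ Forall (good Sg) ts /\
    snd c = combine (seq 0 (abound A)) ts /\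
    ground_counter_support Sg P (asubst (fsubst_fun (snd c)) A) (fun B => In B (fst c)).

Lemma semi_ground_counter_supports Sg P A :
  (exists t, good Sg t) -> safe P -> program_over Sg P -> finitely_recursive Sg P ->
  atom_over Sg A ->
  semi (fun n => exists c, ground_counter_supports Sg P A c /\ n = enc_cs c).
Proof.
  intros Hne HS HP HF HA. set (m := abound A).
  assert (Hth : forall e ts, map (val e) (seq 0 m) = map enc_term ts ->
            Forall (good Sg) ts ->
            let B := asubst (fsubst_fun (combine (seq 0 m) ts)) A in
            agood Sg B /\ eva (val e) A = enc_atom B).
  { intros e ts E Hts. rewrite Forall_forall in Hts.
    pose proof (find_combine_seq e 0 m ts E) as Hfind. split.
    - apply agood_asubst; [exact HA|]. intros x Hx. apply aocc_abound in Hx.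
      apply Hts, Hfind. unfold m. lia.
    - apply eva_asubst. intros x Hx. apply aocc_abound in Hx.
      apply Hfind. unfold m. lia. }
  (* The search is over an environment [e], which determines both the substitution and the atom, and
     a code [k] of the counter-support. [ground_terms_code] ensures that the atom is ground and over
     [Sg], as [counter_support_code_iff] requires. *)
  apply (semi_ext (fun n => exists e k,
    n = cpair k (enc_list (map (fun i => cpair i (val e i)) (seq 0 m))) /\
    ground_terms_code Sg (enc_list (map (val e) (seq 0 m))) /\
    counter_support_code P (eva (val e) A) k)).
  - intros n. split.
    + intros [[K th] [[ts [Hlen [Hts [Hth0 HK]]]] ->]]. cbn [fst snd] in *. subst th.
      fold m in Hlen, HK |- *.
      set (e := env (fun i => enc_term (nth i ts (Var 0))) m).
      assert (E : map (val e) (seq 0 m) = map enc_term ts)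
        by (unfold e; rewrite <- Hlen; apply val_env_terms).
      destruct (Hth e ts E Hts) as [HB EB].
      exists e, (atoms_code K). split; [|split].
      * unfold enc_cs. cbn [fst snd]. rewrite (enc_fsubst_combine e) by exact E. reflexivity.
      * apply ground_terms_code_iff. eauto.
      * rewrite EB. apply (counter_support_code_iff Sg); eauto.
    + intros [e [k [-> [Hg Hk]]]].
      apply ground_terms_code_iff in Hg as [ts [E Hts]].
      destruct (Hth e ts E Hts) as [HB EB]. rewrite EB in Hk.
      apply (counter_support_code_iff Sg) in Hk as [K [-> HK]]; auto.
      exists (K, combine (seq 0 m) ts). split.
      * exists ts. cbn [fst snd].
        split; [|split; [exact Hts|split; [reflexivity|exact HK]]].
        pose proof (f_equal (@length nat) E) as Hl.
        rewrite !length_map, length_seq in Hl. auto.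
      * unfold enc_cs. cbn [fst snd]. rewrite (enc_fsubst_combine e) by exact E. reflexivity.
  - apply semi_ex. apply semi_ex.
    assert (Hseq : forall F : nat -> nat -> nat, (forall i, comp (F i)) ->
              comp (fun n => enc_list (map (fun i => F i n) (seq 0 m)))).
    { intros F HF'. apply (comp_enc_list F). apply Forall_forall. auto. }
    apply semi_and; [|apply semi_and].
    + apply semi_eq; comp_code_tac.
      apply (Hseq (fun i n => cpair i (val (usnd (ufst n)) i))). intros i. comp_code_tac.
    + apply (semi_comp (ground_terms_code Sg)); [apply semi_ground_terms_code|].
      apply (Hseq (fun i n => val (usnd (ufst n)) i)). intros i. comp_code_tac.
    + apply semi_counter_support_code; comp_code_tac.
Qed.

Lemma image_subst_ground s K B :
  (forall C, In C K -> ground_atom C) -> image_subst s K B <-> In B K.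
Proof.
  intros HK. split.
  - intros [C [HC ->]]. rewrite asubst_ground; auto.
  - intros HB. exists B. split; [exact HB|]. symmetry. apply asubst_ground. auto.
Qed.

Lemma ground_counter_support_ext Sg P A K K' :
  (forall B, K B <-> K' B) ->
  ground_counter_support Sg P A K -> ground_counter_support Sg P A K'.
Proof.
  intros H [H1 [H2 H3]]. split; [|split].
  - intros B HB. now apply H1, H.
  - intros S HS. destruct (H2 S HS) as [B [HSB HB]]. exists B. split; [|apply H]; auto.
  - intros B HB. now apply H3, H.
Qed.

(** The instance of [A] and the elements of the counter-support are already ground, so every further
    substitution acts as the identity on them. *)
Lemma ground_counter_supports_gen Sg P A c :
  atom_over Sg A -> ground_counter_supports Sg P A c -> gen_counter_support Sg P A c.
Proof.
  intros HA [ts [Hlen [Hts [Hc HK]]]] s _.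
  assert (HB : ground_atom (asubst (fsubst_fun (snd c)) A)).
  { apply (agood_iff Sg), agood_asubst; [exact HA|]. intros x Hx. apply aocc_abound in Hx.
    rewrite Forall_forall in Hts. apply Hts. rewrite Hc, <- Hlen.
    apply (find_combine_seq _ 0 _ ts (val_env_terms ts)). lia. }
  rewrite (asubst_ground s) by exact HB.
  apply (ground_counter_support_ext _ _ _ (fun B => In B (fst c))); [|exact HK].
  intros B. symmetry. apply image_subst_ground. exact (proj1 HK).
Qed.

Lemma ground_counter_supports_complete Sg P A g K :
  program_over Sg P -> finitely_recursive Sg P ->
  atom_over Sg A -> grounding Sg g ->
  ground_counter_support Sg P (asubst g A) K ->
  exists c, ground_counter_supports Sg P A c /\
    exists s, asubst s (asubst (fsubst_fun (snd c)) A) = asubst g A /\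
              (forall B, K B <-> image_subst s (fst c) B).
Proof.
  intros HP HF HA Hg HK.
  assert (HB : agood Sg (asubst g A)) by (apply agood_asubst; [exact HA|intros x _; apply Hg]).
  pose proof (proj1 (agood_iff _ _) HB) as [HB1 HB2].
  destruct (HF _ HB1 HB2) as [l Hl].
  destruct (classical_filter K l) as [K' HK'].
  assert (Heq : forall B, K B <-> In B K').
  { intros B. rewrite HK'. split; [|tauto]. intros HKB. split; [|exact HKB].
    apply ground_counter_support_iff in HK as [_ [_ H3]].
    destruct (H3 B HKB) as [N [HN HBN]].
    destruct (sup_depends _ _ _ _ HN B HBN) as [B' [[<-|[]] Hd]]. auto. }
  (* The finite substitution is [g] cut down to an initial segment of variables that contains those
     of [A]. *)
  set (ts := map g (seq 0 (abound A))).
  assert (Hth : asubst (fsubst_fun (combine (seq 0 (abound A)) ts)) A = asubst g A).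
  { apply asubst_ext. intros x Hx. apply aocc_abound in Hx.
    unfold ts. assert (Hr : 0 <= x < 0 + abound A) by lia. revert Hr.
    generalize (abound A) as m, 0 as a. clear.
    induction m as [|m IH]; intros a Hx; [lia|]. unfold fsubst_fun. cbn.
    destruct (Nat.eqb_spec a x) as [->|Hne]; [reflexivity|].
    apply (IH (S a)). lia. }
  exists (K', combine (seq 0 (abound A)) ts). cbn [fst snd]. split.
  - exists ts. cbn [fst snd]. unfold ts at 1. rewrite length_map, length_seq, Hth.
    split; [reflexivity|]. split; [|split; [reflexivity|]].
    + apply Forall_map, Forall_forall. intros x _. apply Hg.
    + exact (ground_counter_support_ext _ _ _ _ _ Heq HK).
  - exists g. rewrite Hth. split; [now apply asubst_ground|].
    intros B. rewrite Heq. symmetry. apply image_subst_ground.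
    intros C HC. apply (proj1 HK), Heq, HC.
Qed.

(** * Reduction to safe programs *)

(** If [x] occurs in a body atom but not in the head, one fixed head instance depends on the body
    instances for all values of [x]. Their codes are at least those of the values, hence unbounded,
    which contradicts finite recursion. *)
Lemma safe_of_unbounded Sg P :
  (exists t, good Sg t) -> program_over Sg P -> finitely_recursive Sg P ->
  (forall m, exists t, good Sg t /\ m < enc_term t) -> safe P.
Proof.
  intros [t0 Ht0] HP HF Hunb r B x Hr HB Hx. apply NNPP. intros Hno.
  set (s t y := if Nat.eq_dec y x then t else t0).
  assert (Hs : forall t, good Sg t -> grounding Sg (s t)).
  { intros t Ht y. unfold s. destruct (Nat.eq_dec y x); [apply Ht|apply Ht0]. }
  assert (Hd : forall t, good Sg t ->
            depends Sg P (asubst (s t0) (head r)) (asubst (s t) B)).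
  { intros t Ht. apply rt_step. exists (rsubst (s t) r). split; [|split].
    - exists r, (s t). auto.
    - apply asubst_ext. intros y Hy. unfold s.
      destruct (Nat.eq_dec y x) as [->|]; [contradiction|reflexivity].
    - rewrite <- in_pos, <- in_neg. cbn [rsubst body]. rewrite pos_lsubst, neg_lsubst.
      destruct HB as [HB|HB]; [left|right]; now apply in_map. }
  destruct (HP r Hr) as [Hh _].
  assert (Hg : agood Sg (asubst (s t0) (head r)))
    by (apply agood_asubst; [exact Hh|intros y _; now apply Hs]).
  apply agood_iff in Hg as [Hg1 Hg2]. destruct (HF _ Hg1 Hg2) as [l Hl].
  destruct (Hunb (list_max (map enc_atom l))) as [t [Ht Hlt]].
  pose proof (in_list_max _ _ (in_map enc_atom _ _ (Hl _ (Hd t Ht)))) as Hle.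
  rewrite <- (eva_asubst (fun y => enc_term (s t y)) (s t) B) in Hle by reflexivity.
  pose proof (eva_ge (fun y => enc_term (s t y)) B x Hx) as Hge.
  assert (Hst : s t x = t) by (unfold s; now destruct (Nat.eq_dec x x)).
  cbv beta in Hge. rewrite Hst in Hge. lia.
Qed.

Definition rbound (r : rule) : nat :=
  list_max (map abound (head r :: map lit_atom (body r))).

Lemma rsubst_ext s s' r :
  (forall x, x < rbound r -> s x = s' x) -> rsubst s r = rsubst s' r.
Proof.
  intros H.
  assert (HA : forall A, In A (head r :: map lit_atom (body r)) -> asubst s A = asubst s' A).
  { intros A HA. apply asubst_ext. intros x Hx. apply H. apply aocc_abound in Hx.
    pose proof (in_list_max _ _ (in_map abound _ _ HA)). unfold rbound. lia. }
  unfold rsubst. f_equal; [apply HA; now left|].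
  apply map_ext_in. intros l Hl.
  assert (Hl' : asubst s (lit_atom l) = asubst s' (lit_atom l))
    by (apply HA; right; now apply in_map).
  destruct l; cbn in *; congruence.
Qed.

(** An instance is determined by the values of finitely many variables, so it is named by an
    environment code below a fixed bound. *)
Lemma finite_instances Sg P m :
  (forall t, good Sg t -> enc_term t <= m) ->
  exists l, forall r, ground_instance Sg P r -> In r l.
Proof.
  intros Hm. induction P as [|r0 P [l IH]].
  - exists []. intros r [r0 [s [[] _]]].
  - destruct (classical_list_le (fun e r => exists s,
                e = env (fun x => enc_term (s x)) (rbound r0) /\ r = rsubst s r0)
                (env (fun _ => m) (rbound r0))) as [l' Hl'].
    { intros e r r' [s [-> ->]] [s' [E ->]]. apply rsubst_ext. intros x Hx.
      apply enc_term_inj.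
      rewrite <- (val_env (fun x => enc_term (s x)) (rbound r0) x Hx), E.
      now apply (val_env (fun x => enc_term (s' x))). }
    exists (l' ++ l). intros r [r1 [s [Hr1 [Hs ->]]]]. apply in_or_app.
    destruct Hr1 as [<-|Hr1].
    + left. apply (Hl' (env (fun x => enc_term (s x)) (rbound r0))); [|eauto].
      apply env_mono. intros x. apply Hm, Hs.
    + right. apply IH. exists r1, s. auto.
Qed.

(* Either the Herbrand universe is infinite, and then finite recursion already forces
   the body variables to occur in the head, or there are finitely many ground rules. *)
Lemma safe_equivalent Sg P :
  (exists t, good Sg t) -> program_over Sg P -> finitely_recursive Sg P ->
  exists Q, safe Q /\ program_over Sg Q /\
    forall r, ground_instance Sg Q r <-> ground_instance Sg P r.
Proof.
  intros Hne HP HF.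
  destruct (classic (exists m, forall t, good Sg t -> enc_term t <= m)) as [[m Hm]|Hunb].
  - destruct (finite_instances Sg P m Hm) as [l Hl].
    (* [Q] is the ground instantiation itself. It has no variables, so it is safe, and each of its
       rules is its own only instance. *)
    destruct (classical_filter (ground_instance Sg P) l) as [Q HQ].
    assert (HQ' : forall r, In r Q -> agood Sg (head r) /\
                    forall k, In k (body r) -> agood Sg (lit_atom k)).
    { intros r Hr. apply HQ in Hr as [_ Hr].
      destruct (ground_instance_good Sg P r HP Hr) as [H1 [H2 H3]].
      rewrite Forall_forall in H2, H3. split; [exact H1|].
      intros [B|B] Hk; [apply H2, in_pos, Hk|apply H3, in_neg, Hk]. }
    assert (Hid : forall r s, In r Q -> rsubst s r = r).
    { intros r s Hr. destruct (HQ' r Hr) as [H1 H2]. destruct r as [h b].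
      unfold rsubst. cbn in *. f_equal; [apply asubst_ground, (agood_iff Sg), H1|].
      rewrite <- (map_id b) at 2. apply map_ext_in. intros k Hk. specialize (H2 k Hk).
      apply agood_iff in H2 as [_ H2].
      destruct k; cbn in *; f_equal; now apply asubst_ground. }
    exists Q. split; [|split].
    + intros r B x Hr HB Hx. exfalso. destruct (HQ' r Hr) as [_ H2].
      assert (HBg : agood Sg B).
      { destruct HB as [HB|HB]; [apply in_pos in HB|apply in_neg in HB]; exact (H2 _ HB). }
      apply agood_iff in HBg as [_ HBg]. exact (ground_no_aocc x B HBg Hx).
    + intros r Hr. destruct (HQ' r Hr) as [H1 H2]. split; [now apply agood_iff in H1|].
      intros k Hk. now apply H2, agood_iff in Hk.
    + intros r. split.
      * intros [r0 [s [Hr0 [_ ->]]]]. rewrite Hid by exact Hr0. now apply HQ.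
      * intros Hr. destruct Hne as [t0 Ht0].
        assert (HrQ : In r Q) by (apply HQ; auto).
        exists r, (fun _ => t0). rewrite Hid by exact HrQ.
        repeat split; auto; apply Ht0.
  - exists P. split; [|split; [exact HP|tauto]].
    apply (safe_of_unbounded Sg); auto. intros m. apply NNPP. intros Hno. apply Hunb.
    exists m. intros t Ht. destruct (le_lt_dec (enc_term t) m) as [|Hlt]; [assumption|].
    destruct Hno. eauto.
Qed.

Lemma sup_mono (I J : rule -> Prop) L N :
  (forall r, I r -> J r) -> sup I L N -> sup J L N.
Proof. intros H. induction 1; constructor; auto. Qed.

Lemma ground_counter_support_transfer Sg P Q A K :
  (forall r, ground_instance Sg Q r <-> ground_instance Sg P r) ->
  ground_counter_support Sg Q A K <-> ground_counter_support Sg P A K.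
Proof.
  intros H.
  assert (Hsup : forall N, sup (ground_instance Sg Q) [A] N <->
                           sup (ground_instance Sg P) [A] N)
    by (intros N; split; apply sup_mono; intros r; apply H).
  rewrite !ground_counter_support_iff. setoid_rewrite Hsup. reflexivity.
Qed.

Lemma finitely_recursive_transfer Sg P Q :
  (forall r, ground_instance Sg Q r <-> ground_instance Sg P r) ->
  finitely_recursive Sg P -> finitely_recursive Sg Q.
Proof.
  intros H HF A HA HgA. destruct (HF A HA HgA) as [l Hl]. exists l.
  intros B HB. apply Hl. clear -H HB. induction HB as [A B [r [Hr He]]|A|A B C _ IH1 _ IH2].
  - apply rt_step. exists r. split; [now apply H|exact He].
  - apply rt_refl.
  - exact (rt_trans _ _ _ _ _ IH1 IH2).
Qed.

Theorem theorem6p10 :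
  forall (Sg : signature) (P : program),
    (exists c, In (c, 0) Sg) ->
    program_over Sg P ->
    finitely_recursive Sg P ->
    exists CS : atom -> list atom * fsubst -> Prop,
      counter_supp_function Sg P CS /\
      complete_counter_supp Sg P CS /\
      (forall A, atom_over Sg A -> re (fun n => exists c, CS A c /\ n = enc_cs c)).
Proof.
  intros Sg P [c0 Hc0] HP HF.
  assert (Hne : exists t, good Sg t).
  { exists (Fn c0 []). apply good_Fn. auto. }
  destruct (safe_equivalent Sg P Hne HP HF) as [Q [HS [HQ Heq]]].
  pose proof (finitely_recursive_transfer Sg P Q Heq HF) as HFQ.
  (* Soundness is demanded for all atoms, also those outside the signature; these receive the empty
     set. [Q] may replace [P] because supports depend on a program only through its ground
     instances. *)
  exists (fun A c => atom_over Sg A /\ ground_counter_supports Sg Q A c).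
  split; [|split].
  - intros A c [HA Hc] s Hs.
    apply (ground_counter_support_transfer Sg P Q _ _ Heq).
    exact (ground_counter_supports_gen Sg Q A c HA Hc s Hs).
  - intros A g HA Hg K HK.
    apply (ground_counter_support_transfer Sg P Q _ _ Heq) in HK.
    destruct (ground_counter_supports_complete Sg Q A g K HQ HFQ HA Hg HK) as [c [Hc Hs]].
    exists c. auto.
  - intros A HA. apply semi_re.
    apply (semi_ext (fun n => exists c, ground_counter_supports Sg Q A c /\ n = enc_cs c)).
    + intros n. split; intros [c Hc]; exists c; tauto.
    + now apply semi_ground_counter_supports.
Qed.
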